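(* In the reinforcement-learning network model described in the context, almost surely $F(x_n)\to 0$ and the distance from $x_n$ to $\Gamma$ tends to $0$ as $n\to\infty$.
   Context: Let $G=(\mathbb{V},E)$ be a finite graph with adjacency $i\sim j$ and (unordered) edge set $E$. Let $(a_{ij})_{i,j\in\mathbb{V}}$ be nonnegative reals with $a_{ij}=a_{ji}$ and $a_{ij}>0$ only if $i\sim j$. Let $(p_W)_{W\subseteq\mathbb{V}}$ be nonnegative reals with $\sum_W p_W=1$; for $i\sim j$ put $p_{ij}=\sum_{W:\, i,j\in W}p_W$, and $p_{ij}=0$ if $i\not\sim j$. Assume there exist $i,j$ with $a_{ij}p_{ij}>0$. Let $v^0_{ij}=v^0_{ji}\ge 0$ with $v^0_{ij}>0$ iff $i\sim j$. Process: $V^0_{ij}=v^0_{ij}$, $V^n_{ij}=0$ if $i\not\sim j$, $V_i^n=\sum_j V_{ij}^n$. At each time $n$, each vertex $i$ independently chooses a neighbour $j$ with probability $V_{ij}^n/V_i^n$; independently Nature picks $W_n\subseteq\mathbb{V}$ with $\mathbb{P}(W_n=W)=p_W$, i.i.d. in $n$; if $i,j\in W_n$, $i\sim j$ and $i,j$ choose each other then $V^{n+1}_{ij}=V^{n+1}_{ji}=V^n_{ij}+a_{ij}$, otherwise unchanged. So $\mathbb{P}(V_{ij}^{n+1}=V_{ij}^n+a_{ij}\mid\mathcal{F}_n)=p_{ij}(V_{ij}^n)^2/(V_i^nV_j^n)$. Let $T_n=\sum_{i,j}V_{ij}^n$ (ordered pairs), $x_{ij}^n=V_{ij}^n/T_n$,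 $x_n=(x^n_{ij})$. Let $h_1=\sum_{(i,j):a_{ij}p_{ij}>0}v^0_{ij}/\sum_{k,l}v^0_{kl}$ and let $\Delta$ be the set of arrays $x=(x_{ij})_{i,j\in\mathbb{V}}$ with $x_{ij}=x_{ji}\ge0$, $x_{ij}=0$ if $i\not\sim j$, $\sum_{i,j}x_{ij}=1$ and $\sum_{(i,j):a_{ij}p_{ij}>0}x_{ij}\ge h_1$; write $x_i=\sum_jx_{ij}$. Let $H(x)=\sum_{(i,j):x_{ij}>0}a_{ij}p_{ij}\frac{x_{ij}^2}{x_ix_j}$ and $F(x)_{ij}=x_{ij}\big(a_{ij}p_{ij}\frac{x_{ij}}{x_ix_j}-H(x)\big)$, with the conventions $F(x)_{ij}=0$ if $x_{ij}=0$ and $a_{ij}p_{ij}x_{ij}/(x_ix_j)=0$ if $a_{ij}p_{ij}=0$. Let $\Gamma=\{x\in\Delta: F(x)=0\}$. *)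

(* Defs.v *)
From HB Require Import structures.
From mathcomp Require Import all_boot all_order all_algebra.
From mathcomp Require Import all_classical all_reals all_analysis.
Unset Printing Implicit Defensive.
Import Order.TTheory GRing.Theory Num.Theory.
Local Open Scope ring_scope.
Local Open Scope classical_set_scope.

Definition arr (R : realType) (T : finType) := {ffun T * T -> R}.

Section Model.
Context {R : realType} {T : finType}.
Variable adj : rel T.
Variable a : T -> T -> R.             (* reinforcement amounts a_ij *)
Variable p : {set T} -> R.            (* law of Nature's subset W_n *)

Definition pij (i j : T) : R :=
  if adj i j then \sum_(W : {set T} | (i \in W) && (j \in W)) p W else 0.

Definition rowsum (s : arr R T) (i : T) : R := \sum_(j : T) s (i, j).

(* probability that vertex i chooses neighbour j when the weights are s:
   V_ij / V_i; (convention for an isolated vertex i, where V_i = 0: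
   i makes the void choice "i", which never produces a reinforcement). *)
Definition choice_w (s : arr R T) (i j : T) : R :=
  if rowsum s i == 0 then (j == i)%:R
  else if adj i j then s (i, j) / rowsum s i else 0.

Definition update (s : arr R T) (c : {ffun T -> T}) (W : {set T}) : arr R T :=
  [ffun ij => s ij +
     (if [&& adj ij.1 ij.2, ij.1 \in W, ij.2 \in W,
            c ij.1 == ij.2 & c ij.2 == ij.1]
      then a ij.1 ij.2 else 0)].

(* one-step transition probability from s to s' : vertices choose
   independently, Nature independently picks W. *)
Definition rl_kernel (s s' : arr R T) : R :=
  \sum_(c : {ffun T -> T}) \sum_(W : {set T})
     p W * (\prod_(i : T) choice_w s i (c i)) * (s' == update s c W)%:R.

Definition total (s : arr R T) : R := \sum_(ij : T * T) s ij.
Definition normalize (s : arr R T) : arr R T := [ffun ij => s ij / total s].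

Definition Hfun (x : arr R T) : R :=
  \sum_(ij : T * T | 0 < x ij)
     a ij.1 ij.2 * pij ij.1 ij.2 * (x ij ^+ 2 / (rowsum x ij.1 * rowsum x ij.2)).

Definition ratio (x : arr R T) (i j : T) : R :=
  if a i j * pij i j == 0 then 0
  else a i j * pij i j * x (i, j) / (rowsum x i * rowsum x j).

Definition Ffun (x : arr R T) : arr R T :=
  [ffun ij => if x ij == 0 then 0
              else x ij * (ratio x ij.1 ij.2 - Hfun x)].

Definition h1 (v0 : arr R T) : R :=
  (\sum_(ij : T * T | 0 < a ij.1 ij.2 * pij ij.1 ij.2) v0 ij) / total v0.

Definition Delta (v0 : arr R T) : set (arr R T) :=
  [set x : arr R T | (forall i j, x (i, j) = x (j, i)) /\ (forall ij, 0 <= x ij) /\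
           (forall i j, ~~ adj i j -> x (i, j) = 0) /\ total x = 1 /\
           h1 v0 <= \sum_(ij : T * T | 0 < a ij.1 ij.2 * pij ij.1 ij.2) x ij].

Definition Gamma (v0 : arr R T) : set (arr R T) :=
  [set x : arr R T | Delta v0 x /\ Ffun x = [ffun _ => 0]].

(* Euclidean distance and distance to a set (in \bar R; +oo for the empty set) *)
Definition eucl (x y : arr R T) : R := Num.sqrt (\sum_(ij : T * T) (x ij - y ij) ^+ 2).
Definition dist_set (x : arr R T) (A : set (arr R T)) : \bar R :=
  ereal_inf [set (eucl x y)%:E | y in A].

End Model.

(* Main.v *)
Require Import Defs.
From HB Require Import structures.
From mathcomp Require Import all_boot all_order all_algebra.
From mathcomp Require Import all_classical all_reals all_analysis.
From mathcomp Require Import ring lra.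
Import Order.TTheory GRing.Theory Num.Theory numFieldNormedType.Exports.
Local Open Scope ring_scope.
Local Open Scope classical_set_scope.

(** Put [t = n + 1], [w_ij = a_ij p_ij], [r_ij = w_ij V_ij / (V_i V_j)],
    [m_ij = r_ij V_ij] (the conditional expectation of the increment of [V_ij])
    and [u_ij = V_ij / t].  Everything follows from the almost sure convergence
    to [0] of

      [E_n = \sum_ij (m_ij - u_ij)^2 / (m_ij + u_ij)
           = \sum_ij (m_ij - 3 u_ij + 4 u_ij / (1 + t r_ij))].

    With [r_i = (\sum_j m_ij) / V_i], the total rate [H = \sum_ij m_ij] has
    drift [2 D], where [D = \sum_ij V_ij (r_ij - r_i)^2], because
    [\sum_j V_ij (r_ij - r_i) = 0].  The same cancellation shows that the jumps
    raise [E_n] by at most [4 D] on average, while the passage of time lowers it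
    by at least [E_n / (t + 1)].  The second order terms at a vertex are
    [O(1 / V_i^2)] per jump, and the decrease of [1 / V_i] pays for them.  Hence
    [E (E_(n+1) - E_n | F_n) <= - E_n / (t + 1) + E (B_(n+1) - B_n | F_n)] for a
    bounded submartingale [B_n].  Taking expectations and using the divergence of
    the harmonic series, [E E_m + E (B_N - B_m)] is uniformly small in [N >= m]
    for suitable [m]; Ville's inequality then bounds the probability that [E_n]
    exceeds [eps] after time [m].

    Finally [F_ij(x_n) = (m_ij - u_ij) + x_ij \sum_kl (u_kl - m_kl)] tends to
    [0], and limit points of [x_n] lie in [Gamma]. *)

Set Implicit Arguments.
Unset Strict Implicit.

Ltac pos := by repeat first
  [ done | apply: ler01 | apply: ltr01 | apply: sqr_ge0
  | apply: addr_ge0 | apply: mulr_ge0 | apply: divr_ge0 | apply: exprn_ge0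
  | rewrite invr_ge0 | apply: mulr_gt0 | apply: divr_gt0 | apply: exprn_gt0
  | rewrite invr_gt0 | apply: ltr_pwDl | apply: ltW ].

(** * Inequalities for a single edge *)

Section EdgeInequalities.
Context {R : realType}.
Implicit Types w X Y Z x y z t u k nu : R.

(* Tangent inequality for the concave function [(u, q) |-> u q / (u + q)] at
   [q = 1 / nu], [q' = k / nu]; the variable [nu] makes room for [nu = 0]. *)
Lemma harmonic_tangent u u' nu k : 0 <= u -> 0 <= u' -> 0 <= nu -> 0 < k ->
  u' / (1 + u' * nu / k) <=
  u / (1 + u * nu) + (u' - u + (k - 1) * (u ^+ 2 * nu)) / (1 + u * nu) ^+ 2.
Proof.
move=> u0 u'0 nu0 k0.
have unu0 : 0 <= u * nu by exact: mulr_ge0.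
have unu1 : 1 + u * nu != 0 by rewrite gt_eqF// ltr_pwDl.
have u'nu0 : 0 <= u' * nu by exact: mulr_ge0.
have ku'nu0 : 0 < k + u' * nu by exact: ltr_pwDl.
rewrite -subr_ge0.
have -> : u / (1 + u * nu) + (u' - u + (k - 1) * (u ^+ 2 * nu)) / (1 + u * nu) ^+ 2
   - u' / (1 + u' * nu / k) =
   nu * (u' - k * u) ^+ 2 / ((1 + u * nu) ^+ 2 * (k + u' * nu)).
  by field; rewrite ?unu1 ?gt_eqF.
apply: divr_ge0; first by rewrite mulr_ge0// sqr_ge0.
by rewrite mulr_ge0 ?sqr_ge0// ltW.
Qed.

(** First-order expansion of [w X^2 / (Y Z)] under a jump, bounded from below. After division by [Y]
    and [Z] the errors are products of relative increments, controlled by [y / Y] and [z / Z]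
    because [x] is at most [y] and [z]; the constant [c] absorbs the cubic ones. *)
Lemma match_rate_increment w X Y Z x y z c : 0 <= w -> 0 <= c ->
  0 < X -> X <= Y -> X <= Z -> 0 <= x -> x <= y -> x <= z ->
  y / Y <= c -> z / Z <= c ->
  w * X / (Y * Z) * X * (1 - y / Y - z / Z) + 2 * (w * X / (Y * Z)) * x
    - w * ((2 + c) * ((y / Y) ^+ 2 + (z / Z) ^+ 2)) <=
  w * (X + x) / ((Y + y) * (Z + z)) * (X + x).
Proof.
move=> w0 c0 X0 XY XZ x0 xy xz yc zc.
have Y0 : 0 < Y by exact: lt_le_trans XY.
have Z0 : 0 < Z by exact: lt_le_trans XZ.
have y0 : 0 <= y by exact: le_trans xy.
have z0 : 0 <= z by exact: le_trans xz.
set e := y / Y in yc *; set f := z / Z in zc *.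
have e0 : 0 <= e by rewrite divr_ge0// ltW.
have f0 : 0 <= f by rewrite divr_ge0// ltW.
have -> : w * (X + x) / ((Y + y) * (Z + z)) * (X + x) =
  w * ((X / Y + x / Y) * (X / Z + x / Z) / ((1 + e) * (1 + f))).
  by rewrite /e /f; field; rewrite ?gt_eqF// ?ltr_pwDl// ?addr_gt0// ltr_pwDl.
have -> : w * X / (Y * Z) * X * (1 - e - f) + 2 * (w * X / (Y * Z)) * x
    - w * ((2 + c) * (e ^+ 2 + f ^+ 2)) =
  w * (X / Y * (X / Z) * (1 - e - f) + X / Y * (x / Z) + X / Z * (x / Y)
   - (2 + c) * (e ^+ 2 + f ^+ 2)).
  by field; rewrite ?gt_eqF.
apply: ler_wpM2l => //.
have xYe : x / Y <= e by rewrite ler_wpM2r// invr_ge0 ltW.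
have xZf : x / Z <= f by rewrite ler_wpM2r// invr_ge0 ltW.
have XY1 : X / Y <= 1 by rewrite ler_pdivrMr// mul1r.
have XZ1 : X / Z <= 1 by rewrite ler_pdivrMr// mul1r.
have XY0 : 0 <= X / Y by rewrite divr_ge0// ltW.
have XZ0 : 0 <= X / Z by rewrite divr_ge0// ltW.
have xY0 : 0 <= x / Y by rewrite divr_ge0// ltW.
have xZ0 : 0 <= x / Z by rewrite divr_ge0// ltW.
(* The four quotients are about to become free variables; this identity records how they are
   linked. *)
have E : X / Y * (x / Z) = X / Z * (x / Y) by field; rewrite ?gt_eqF.
move: (X / Y) (X / Z) (x / Y) (x / Z) E xYe xZf XY1 XZ1 XY0 XZ0 xY0 xZ0.
move=> A B al be E ale bef A1 B1 A0 B0 al0 be0.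
clearbody e f.
have sq : 2 * e * f <= e ^+ 2 + f ^+ 2 by have := sqr_ge0 (e - f); nra.
(* [(1 + e) (1 + f) (1 - e - f) <= 1] for nonnegative [e] and [f]. *)
have K : (A + al) * (B + be) * (1 - e - f) <= (A + al) * (B + be) / ((1 + e) * (1 + f)).
  apply: ler_wpM2l; first by rewrite mulr_ge0// addr_ge0.
  rewrite -div1r ler_pdivlMr; last by rewrite mulr_gt0// ltr_pwDl.
  by nra.
apply: le_trans K.
have Abe : A * be <= f by nra.
have Bal : A * be <= e by rewrite E; nra.
have albe : al * be <= e * f by nra.
have q1 : A * be * (e + f) <= e ^+ 2 + f ^+ 2 by nra.
have q2 : al * be * (e + f) <= c * (e ^+ 2 + f ^+ 2).
  have : al * be * (e + f) <= e * f * (e + f) by rewrite ler_wpM2r// addr_ge0.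
  have : e * f * (e + f) <= e * f * (c + c) by apply: ler_wpM2l; [exact: mulr_ge0|exact: lerD].
  have : c * (e * f * 2) <= c * (e ^+ 2 + f ^+ 2) by apply: ler_wpM2l => //; rewrite mulrC mulrA.
  by nra.
have albe0 : 0 <= al * be by exact: mulr_ge0.
rewrite -E.
have -> : (A + al) * (B + be) = A * B + A * be + A * be + al * be by rewrite {2}E; ring.
by nra.
Qed.

(** [u / (1 + t r)] is the concave function [u q / (u + q)] of [u = X / t] and [q = Y Z / (w t^2)],
    so [harmonic_tangent] applies. Its parameter [k = (1 + y / Y) (1 + z / Z) (t / (t + 1))^2] is
    the factor by which [q] changes in one step. *)
Lemma potential_increment w X Y Z x y z t : 0 <= w ->
  0 < X -> 0 < Y -> 0 < Z -> 0 <= x -> 0 <= y -> 0 <= z -> 0 < t ->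
  (X + x) / (t + 1) / (1 + (t + 1) * (w * (X + x) / ((Y + y) * (Z + z)))) <=
  X / t / (1 + t * (w * X / (Y * Z))) +
  ((x - X / t) / (t + 1) + w * X / (Y * Z) * X *
     (y / Y + z / Z + y / Y * (z / Z) - 2 / (t + 1) + (t + 1) ^- 2)) /
    (1 + t * (w * X / (Y * Z))) ^+ 2.
Proof.
move=> w0 X0 Y0 Z0 x0 y0 z0 t0.
have t10 : 0 < t + 1 by rewrite addr_gt0.
have e0 : 0 <= y / Y by rewrite divr_ge0// ltW.
have f0 : 0 <= z / Z by rewrite divr_ge0// ltW.
have Yy : 0 < Y + y by rewrite ltr_pwDl.
have Zz : 0 < Z + z by rewrite ltr_pwDl.
have n0 : 0 <= t * (w * X / (Y * Z)).
  by apply: mulr_ge0; [exact: ltW|apply: divr_ge0; apply: mulr_ge0 => //; exact: ltW].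
have := @harmonic_tangent (X / t) ((X + x) / (t + 1)) (w * t ^+ 2 / (Y * Z))
  ((1 + y / Y) * (1 + z / Z) * (t / (t + 1)) ^+ 2).
have -> : X / t * (w * t ^+ 2 / (Y * Z)) = t * (w * X / (Y * Z)).
  by field; rewrite ?gt_eqF.
have -> : (X + x) / (t + 1) * (w * t ^+ 2 / (Y * Z)) /
    ((1 + y / Y) * (1 + z / Z) * (t / (t + 1)) ^+ 2) =
   (t + 1) * (w * (X + x) / ((Y + y) * (Z + z))).
  by field; rewrite ?gt_eqF.
have -> : (X / t) ^+ 2 * (w * t ^+ 2 / (Y * Z)) = w * X / (Y * Z) * X.
  by field; rewrite ?gt_eqF.
move=> H; apply: le_trans (H _ _ _ _) _; [pos|pos|pos|pos|].
rewrite lerD2l; apply: ler_wpM2r; first pos.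
have -> : (X + x) / (t + 1) - X / t = (x - X / t) / (t + 1).
  by field; rewrite ?gt_eqF.
rewrite lerD2l mulrC; apply: ler_wpM2l; first pos.
(* The other two factors of [k] are at least 1, so the loss [2 / (t + 1) - (t + 1)^-2] may be
   counted with coefficient 1. *)
have -> : (t / (t + 1)) ^+ 2 = 1 - (2 / (t + 1) - (t + 1) ^- 2).
  by field; rewrite ?gt_eqF.
have : 0 <= 2 / (t + 1) - (t + 1) ^- 2.
  have -> : 2 / (t + 1) - (t + 1) ^- 2 = (2 * t + 1) / (t + 1) ^+ 2.
    by field; rewrite ?gt_eqF.
  pos.
have : 0 <= y / Y * (z / Z) by exact: mulr_ge0.
by nra.
Qed.

(** With [v = t r] this is [(v - 1)^2 / (v + 1) = v - 3 + 4 / (v + 1)], multiplied by [X / t]. *)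
Lemma excess_split (X t r : R) : 0 < t -> 0 <= r ->
  X / t * (t * r - 1) ^+ 2 / (t * r + 1) =
  r * X - 3 * (X / t) + 4 * (X / t / (1 + t * r)).
Proof.
move=> t0 r0; have D0 : 0 < 1 + t * r by pos.
have D1 : 0 < t * r + 1 by rewrite addrC.
by field; rewrite !gt_eqF.
Qed.

(** The left-hand side is what remains of the drift of one edge once the multiples of
    [2 r - r_i - r_j] are split off. The two sides differ by a nonnegative multiple of [(t r - 1)^2]
    plus one of [2 / (t + 1) - r / (1 + t r)^2], which is nonnegative for [t >= 1]. *)
Lemma time_drift_le (X t r : R) : 0 <= X -> 1 <= t -> 0 <= r ->
  8 * (1 + t * r) ^- 2 * (r * X) * r + 4 * (1 + t * r) ^- 2 * (r * X - X / t) / (t + 1)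
   - 8 * (1 + t * r) ^- 2 * (r * X) / (t + 1) - 3 * (r * X - X / t) / (t + 1) <=
  - (X / t * (t * r - 1) ^+ 2 / (t * r + 1)) / (t + 1) + 16 * (r * X) * (t + 1) ^- 2.
Proof.
move=> X0 t1 r0; have t0 : 0 < t by exact: lt_le_trans t1.
have D0 : 0 < 1 + t * r by pos.
have D1 : 0 < t * r + 1 by rewrite addrC.
have t10 : 0 < t + 1 by pos.
rewrite -subr_ge0.
have -> : - (X / t * (t * r - 1) ^+ 2 / (t * r + 1)) / (t + 1) + 16 * (r * X) * (t + 1) ^- 2 -
  (8 * (1 + t * r) ^- 2 * (r * X) * r + 4 * (1 + t * r) ^- 2 * (r * X - X / t) / (t + 1)
   - 8 * (1 + t * r) ^- 2 * (r * X) / (t + 1) - 3 * (r * X - X / t) / (t + 1)) =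
  2 * r * X * (t * r - 1) ^+ 2 / ((1 + t * r) ^+ 2 * (t + 1)) +
  8 * (r * X) / (t + 1) * (2 / (t + 1) - r / (1 + t * r) ^+ 2).
  by field; rewrite !gt_eqF.
apply: addr_ge0; first pos.
apply: mulr_ge0; first pos.
rewrite subr_ge0 ler_pdivrMr; last pos.
rewrite mulrAC ler_pdivlMr //.
have trr : r <= t * r by rewrite ler_peMl.
have : 0 <= t * r by pos.
by nra.
Qed.

(* The derivative of [r |-> (1 - 4 / (1 + t r)^2) r] is at most [5 / 4]. *)
Lemma damped_rate_lipschitz (t r r' : R) : 0 <= t -> 0 <= r -> 0 <= r' ->
  (r - r') * ((1 - 4 / (1 + t * r) ^+ 2) * r - (1 - 4 / (1 + t * r') ^+ 2) * r')
   <= 2 * (r - r') ^+ 2.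
Proof.
move=> t0 r0 r'0.
have N0 : 0 <= t * r by exact: mulr_ge0.
have N'0 : 0 <= t * r' by exact: mulr_ge0.
have D0 : 0 < 1 + t * r by exact: ltr_pwDl.
have D'0 : 0 < 1 + t * r' by exact: ltr_pwDl.
have -> : (r - r') * ((1 - 4 / (1 + t * r) ^+ 2) * r - (1 - 4 / (1 + t * r') ^+ 2) * r')
  = (1 - 4 / ((1 + t * r) ^+ 2 * (1 + t * r') ^+ 2)
     + 4 * (t * r / (1 + t * r) ^+ 2) * (t * r' / (1 + t * r') ^+ 2)) * (r - r') ^+ 2.
  by field; rewrite !gt_eqF.
apply: ler_wpM2r; first exact: sqr_ge0.
have q (v : R) : 0 <= v -> 0 <= v / (1 + v) ^+ 2 <= 1 / 4.
  move=> v0; rewrite divr_ge0 ?sqr_ge0//=.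
  rewrite ler_pdivrMr; last pos.
  by have := sqr_ge0 (v - 1); nra.
have /andP[a0 a1] := q _ N0; have /andP[b0 b1] := q _ N'0.
have : 0 <= 4 / ((1 + t * r) ^+ 2 * (1 + t * r') ^+ 2).
  by rewrite divr_ge0// mulr_ge0// sqr_ge0.
by nra.
Qed.

End EdgeInequalities.

(** * Sequences and ultrafilters *)

Section AlmostSupermartingale.
Context {R : realType}.

(** Otherwise, once [b] is within [eta / 2] of its limit, [e] never falls below [eta / 2]. The
    recursion then removes [eta / 2] times a divergent harmonic tail from [e], while [b] gives back
    only a bounded amount. *)
Lemma almost_supermartingale_small (e b : nat -> R) (C : R) :
  (forall n, 0 <= e n) ->
  (forall n, e n.+1 <= e n - e n / n.+2%:R + (b n.+1 - b n)) ->
  (forall n, b n <= b n.+1) -> (forall n, b n <= C) ->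
  forall eta : R, 0 < eta -> exists m, forall N, (m <= N)%N -> e m + (b N - b m) <= eta.
Proof.
move=> e0 estep bS bC eta eta0.
have bmon : nondecreasing_seq b by apply/nondecreasing_seqP.
have bcvg : cvgn b.
  by apply: nondecreasing_is_cvgn => //; exists C => _ [n _ <-].
have bL n : b n <= limn b by exact: nondecreasing_cvgn_le.
have eta20 : 0 < eta / 2 by rewrite divr_gt0.
have [m0 _ m0P] : \forall n \near \oo, limn b - b n < eta / 2.
  move/cvgrPdist_lt : bcvg => /(_ _ eta20); apply: filterS => n.
  by rewrite ger0_norm// subr_ge0.
apply: contrapT => /forallNP small.
have elb m : (m0 <= m)%N -> eta / 2 <= e m.
  move=> m0m; rewrite leNgt; apply/negP => em; apply: (small m) => N mN.
  have := m0P m m0m; have := bL N => bN /= bm.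
  rewrite [leRHS]splitr lerD// ?ltW//.
  by apply: le_lt_trans bm; rewrite lerD2r.
(* Step [n] removes [e n / n.+2], and [harmonic n.+1] is the inverse of [n.+2]; hence the partial
   sums are taken up to successors. *)
have tele k : e (m0 + k)%N + eta / 2 * (series harmonic (m0 + k).+1 - series harmonic m0.+1)
    <= e m0 + (b (m0 + k)%N - b m0).
  elim: k => [|k IH]; first by rewrite addn0 !subrr mulr0.
  rewrite addnS /series /= big_nat_recr//= -/(series harmonic (m0 + k).+1).
  have := estep (m0 + k)%N; have := elb (m0 + k)%N (leq_addr _ _) => elk.
  have : eta / 2 * (m0 + k).+2%:R^-1 <= e (m0 + k)%N / (m0 + k).+2%:R.
    by rewrite ler_wpM2r// invr_ge0 ler0n.
  move: IH; rewrite /harmonic/=; move: ((m0 + k).+2%:R^-1) => q.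
  by rewrite /series /=; lra.
apply: (@dvg_harmonic R); apply: nondecreasing_is_cvgn.
  apply/nondecreasing_seqP => n; rewrite /series /= big_nat_recr//= lerDl.
  exact: harmonic_ge0.
exists (series harmonic m0.+1 + (e m0 + (C - b m0)) / (eta / 2)) => _ [n _ <-].
apply: (@le_trans _ _ (series harmonic (m0 + n).+1)).
  have : nondecreasing_seq (series (@harmonic R)).
    apply/nondecreasing_seqP => k; rewrite /series /= big_nat_recr//= lerDl.
    exact: harmonic_ge0.
  by apply; rewrite ltnW// ltnS leq_addl.
rewrite -lerBlDl ler_pdivlMr// mulrC.
have := tele n; have := e0 (m0 + n)%N; have := bC (m0 + n)%N.
by lra.
Qed.

End AlmostSupermartingale.

Section Ultralimits.
Context {R : realType} {I : Type}.

(** Replaces the extraction of a subsequence: the image filter has a cluster point in the compact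
    segment, and an ultrafilter converges to each of its cluster points. *)
Lemma ultra_bounded_cvg (G : set_system I) (GU : UltraFilter G) (f : I -> R) (b c : R) :
  (forall n, b <= f n <= c) -> exists l : R, f @ G --> l.
Proof.
move=> fbc.
have Gbc : G (f @^-1` `[b, c]%classic).
  by apply: filterE => n /=; rewrite in_itv/= fbc.
have [l [_ lG]] := segment_compact (fmap_proper_filter f (ultra_proper : ProperFilter G)) Gbc.
exists l => A lA; have [//|GA] := in_ultra_setVsetC (f @^-1` A) GU.
by have [x [nAx Ax]] := lG _ _ (GA : (f @ G) (~` A)) lA.
Qed.

Lemma cvg_sumr (G : set_system I) (FG : Filter G) (J : Type) (r : seq J) (Q : pred J)
    (f : J -> I -> R) (l : J -> R) :
  (forall j, f j @ G --> l j) ->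
  (fun n => \sum_(j <- r | Q j) f j n) @ G --> \sum_(j <- r | Q j) l j.
Proof. by move=> fl; apply: cvg_big => [|j _]; [exact: add_continuous|exact: fl]. Qed.

End Ultralimits.
(** * One step of the process *)

Section Model.
Context {R : realType} {T : finType}.
Variables (adj : rel T) (a : T -> T -> R) (p : {set T} -> R) (v0 : arr R T).
Hypothesis adjC : forall i j, adj i j = adj j i.
Hypothesis adj_irr : forall i, ~~ adj i i.
Hypothesis a_ge0 : forall i j, 0 <= a i j.
Hypothesis aC : forall i j, a i j = a j i.
Hypothesis p_ge0 : forall W, 0 <= p W.
Hypothesis p_sum : \sum_(W : {set T}) p W = 1.
Hypothesis v0C : forall i j, v0 (i, j) = v0 (j, i).
Hypothesis v0_ge0 : forall ij, 0 <= v0 ij.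
Hypothesis v0_adj : forall i j, 0 < v0 (i, j) <-> adj i j.

Notation outcome := ({ffun T -> T} * {set T})%type.
Implicit Types (s : arr R T) (o : outcome).

Definition weight (i j : T) : R := a i j * pij adj p i j.

Definition gain o (i j : T) : R :=
  if [&& adj i j, i \in o.2, j \in o.2, o.1 i == j & o.1 j == i]
  then a i j else 0.

Definition gainsum o i : R := \sum_j gain o i j.

Definition next s o : arr R T := update adj a s o.1 o.2.

Definition outcome_prob s o : R := p o.2 * \prod_(i : T) choice_w adj s i (o.1 i).

Definition mean s (f : outcome -> R) : R := \sum_o outcome_prob s o * f o.

(** Only Nature's set is required to have positive probability; the choices of the vertices are
    unrestricted, since the invariants below hold for all of them. *)
Fixpoint reach (n : nat) : set (arr R T) :=
  if n is n'.+1 then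
    \bigcup_(s in reach n') [set next s o | o in [set o : outcome | 0 < p o.2]]
  else [set v0].

Lemma nextE s o i j : next s o (i, j) = s (i, j) + gain o i j.
Proof. by rewrite ffunE. Qed.

Lemma rowsum_next s o i : rowsum (next s o) i = rowsum s i + gainsum o i.
Proof. by rewrite /rowsum -big_split; apply: eq_bigr => j _; rewrite nextE. Qed.

Lemma gain_ge0 o i j : 0 <= gain o i j.
Proof. by rewrite /gain; case: ifP. Qed.

Lemma gain_le o i j : gain o i j <= a i j.
Proof. by rewrite /gain; case: ifP. Qed.

Lemma gainC o i j : gain o i j = gain o j i.
Proof.
rewrite /gain adjC aC; congr (if _ then _ else _).
by case: (adj j i); case: (i \in _); case: (j \in _); case: (_ == j); case: (_ == i).
Qed.

Lemma gain_nadj o i j : ~~ adj i j -> gain o i j = 0.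
Proof. by rewrite /gain => /negPf ->. Qed.

(** A match needs a set containing both ends, and the probability of such a set is at most
    [p_ij]. *)
Lemma gain_weight0 o i j : 0 < p o.2 -> weight i j = 0 -> gain o i j = 0.
Proof.
move=> p0 /eqP; rewrite mulf_eq0 /gain => /orP[/eqP->|]; first by rewrite if_same.
case: ifP => // /and5P[ij iW jW _ _]; rewrite /pij ij => /eqP pij0.
suff : p o.2 <= 0 by rewrite leNgt p0.
by rewrite -pij0 (bigD1 o.2) /= ?iW ?jW// lerDl sumr_ge0.
Qed.

Lemma gain_le_sum o i j : gain o i j <= gainsum o i.
Proof. by rewrite /gainsum (bigD1 j)//= lerDl sumr_ge0// => k _; exact: gain_ge0. Qed.

Lemma gainsum_ge0 o i : 0 <= gainsum o i.
Proof. by apply: sumr_ge0 => j _; exact: gain_ge0. Qed.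

Definition gain_bound : R := 1 + \sum_i \sum_j a i j.

Lemma gain_bound_ge1 : 1 <= gain_bound.
Proof. by rewrite lerDl; apply: sumr_ge0 => i _; apply: sumr_ge0. Qed.

Lemma gainsum_le o i : gainsum o i <= gain_bound.
Proof.
apply: (@le_trans _ _ (\sum_j a i j)); first by apply: ler_sum => j _; exact: gain_le.
rewrite /gain_bound [X in 1 + X](bigD1 i)//= addrCA lerDl addr_ge0//.
by apply: sumr_ge0 => k _; apply: sumr_ge0.
Qed.

Lemma weight_ge0 i j : 0 <= weight i j.
Proof. by rewrite mulr_ge0// /pij; case: ifP => // _; exact: sumr_ge0. Qed.

Lemma weightC i j : weight i j = weight j i.
Proof.
rewrite /weight aC /pij adjC; congr (_ * _); case: ifP => // _.
by apply: eq_bigl => W; rewrite andbC.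
Qed.

Lemma weight_adj i j : 0 < weight i j -> adj i j.
Proof. by rewrite /weight /pij; case: ifP => //; rewrite mulr0 ltxx. Qed.

(** The invariants through which states enter the estimates. [adm_le] keeps [V_ij / (n + 1)]
    bounded, and [adm_weight0] freezes the edges that never reinforce, which gives the mass
    condition of [Delta]. *)
Record admissible (n : nat) s : Prop := Admissible {
  admC : forall i j, s (i, j) = s (j, i);
  adm_ge : forall ij, v0 ij <= s ij;
  adm_nadj : forall i j, ~~ adj i j -> s (i, j) = 0;
  adm_le : forall i j, s (i, j) <= v0 (i, j) + n%:R * a i j;
  adm_weight0 : forall i j, weight i j = 0 -> s (i, j) = v0 (i, j) }.

Lemma reach_admissible n s : reach n s -> admissible n s.
Proof.
elim: n s => [s ->|n IH s [s' /IH[sC sge snadj sle sw0] [oc p0 <-]]].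
  split=> //= [i j nij|i j]; last by rewrite mul0r addr0.
  by apply/eqP; rewrite eq_le v0_ge0 andbT leNgt; apply/negP => /v0_adj; apply/negP.
split=> [i j|[i j]|i j nij|i j|i j w0]; rewrite !nextE.
- by rewrite sC gainC.
- by rewrite (le_trans (sge _))// lerDl gain_ge0.
- by rewrite snadj// gain_nadj// addr0.
- by rewrite -natr1 mulrDl mul1r addrA lerD// gain_le.
- by rewrite sw0// gain_weight0// addr0.
Qed.

Lemma admissible_ge0 n s : admissible n s -> forall ij, 0 <= s ij.
Proof. by move=> [_ sge _ _ _] ij; exact: le_trans (sge ij). Qed.

Lemma admissible_gt0 n s : admissible n s -> forall i j, adj i j -> 0 < s (i, j).
Proof. by move=> [_ sge _ _ _] i j /v0_adj v0_gt; exact: lt_le_trans (sge (i, j)). Qed.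

Lemma admissible_le_rowsum n s : admissible n s -> forall i j, s (i, j) <= rowsum s i.
Proof.
move=> sn i j; rewrite /rowsum (bigD1 j)//= lerDl sumr_ge0// => k _.
exact: admissible_ge0 sn _.
Qed.

Lemma rowsum_ge0 n s : admissible n s -> forall i, 0 <= rowsum s i.
Proof. by move=> sn i; apply: sumr_ge0 => j _; exact: admissible_ge0 sn _. Qed.

Lemma choice_w_sum n s i : admissible n s -> \sum_j choice_w adj s i j = 1.
Proof.
move=> sn; rewrite /choice_w; case: eqVneq => [_|Y0].
  rewrite (bigD1 i)//= eqxx big1 ?addr0// => j /negPf ->; by [].
rewrite -[RHS](divff Y0) {2}/rowsum mulr_suml; apply: eq_bigr => j _.
by case: ifPn => // nij; rewrite (adm_nadj sn)// mul0r.
Qed.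

Lemma choice_w_ge0 n s i j : admissible n s -> 0 <= choice_w adj s i j.
Proof.
move=> sn; rewrite /choice_w; case: ifP => _; first by rewrite ler0n.
case: ifP => // _; apply: divr_ge0; [exact: admissible_ge0 sn _|exact: rowsum_ge0 sn _].
Qed.

Lemma outcome_prob_ge0 n s o : admissible n s -> 0 <= outcome_prob s o.
Proof. by move=> sn; apply: mulr_ge0 => //; apply: prodr_ge0 => i _; exact: choice_w_ge0 sn. Qed.

Lemma outcome_prob_gt0 s o : outcome_prob s o != 0 -> 0 < p o.2.
Proof. by rewrite mulf_eq0 negb_or lt_neqAle p_ge0 andbT eq_sym => /andP[]. Qed.

(** * Expectation over the outcome of one step *)

Lemma mean_pair s (f : {ffun T -> T} -> {set T} -> R) :
  mean s (fun o => f o.1 o.2) =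
  \sum_(c : {ffun T -> T}) \sum_(W : {set T}) p W * (\prod_(i : T) choice_w adj s i (c i)) * f c W.
Proof. by rewrite /mean pair_big /=; apply: eq_bigr => -[c W]. Qed.

Lemma mean_indep n s (f : {ffun T -> T} -> R) (g : {set T} -> R) : admissible n s ->
  mean s (fun o => f o.1 * g o.2) =
  (\sum_(c : {ffun T -> T}) (\prod_i choice_w adj s i (c i)) * f c) * \sum_W p W * g W.
Proof.
move=> sn; rewrite (mean_pair s (fun c W => f c * g W)) mulr_suml; apply: eq_bigr => c _.
by rewrite mulr_sumr; apply: eq_bigr => W _; ring.
Qed.

Lemma mean_cst n s (k : R) : admissible n s -> mean s (fun=> k) = k.
Proof.
move=> sn; rewrite -[LHS]/(mean s (fun o => k)).
have -> : (fun _ : outcome => k) = (fun o => k * 1) by apply/funext => o; rewrite mulr1.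
rewrite (mean_indep (fun=> k) (fun=> 1) sn).
under [X in _ * X]eq_bigr do rewrite mulr1.
rewrite p_sum mulr1 -mulr_suml.
rewrite -(bigA_distr_bigA (fun i j => choice_w adj s i j)) big1 ?mul1r// => i _.
exact: choice_w_sum sn.
Qed.

Lemma mean_le n s (f g : outcome -> R) : admissible n s ->
  (forall o, 0 < p o.2 -> f o <= g o) -> mean s f <= mean s g.
Proof.
move=> sn fg; apply: ler_sum => o _.
have [->|/outcome_prob_gt0/fg fgo] := eqVneq (outcome_prob s o) 0; first by rewrite !mul0r.
by rewrite ler_wpM2l// (outcome_prob_ge0 _ sn).
Qed.

Lemma eq_mean s (f g : outcome -> R) : f =1 g -> mean s f = mean s g.
Proof. by move=> /funext ->. Qed.

Lemma meanD s (f g : outcome -> R) : mean s (fun o => f o + g o) = mean s f + mean s g.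
Proof. by rewrite /mean -big_split; apply: eq_bigr => o _; rewrite mulrDr. Qed.

Lemma meanZ s (k : R) (f : outcome -> R) : mean s (fun o => k * f o) = k * mean s f.
Proof. by rewrite /mean mulr_sumr; apply: eq_bigr => o _; rewrite mulrCA. Qed.

Lemma mean_sum (I : finType) s (f : I -> outcome -> R) :
  mean s (fun o => \sum_i f i o) = \sum_i mean s (f i).
Proof. by rewrite /mean exchange_big; apply: eq_bigr => o _; rewrite mulr_sumr. Qed.

Definition rate s (i j : T) : R := weight i j * s (i, j) / (rowsum s i * rowsum s j).

(** Nature's set is independent of the choices, and the choices of the distinct vertices [i] and [j]
    are independent of each other. *)
Lemma mean_gain n s i j : admissible n s ->
  mean s (fun o => gain o i j) = rate s i j * s (i, j).
Proof.
move=> sn; rewrite /rate /weight /pij; case: ifPn => [ij|nij]; last first.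
  rewrite mulr0 !mul0r -[RHS](mean_cst 0 sn).
  by apply: eq_mean => o; rewrite gain_nadj.
have ji : adj j i by rewrite -adjC.
have neq_ij : i != j by apply: contraTneq ij => ->.
have neq_ji : j != i by rewrite eq_sym.
have Yi : 0 < rowsum s i.
  by rewrite (lt_le_trans (admissible_gt0 sn ij))// (admissible_le_rowsum sn).
have Yj : 0 < rowsum s j.
  by rewrite (lt_le_trans (admissible_gt0 sn ji))// (admissible_le_rowsum sn).
have -> : mean s (fun o => gain o i j) =
    mean s (fun o => (((o.1 i == j) && (o.1 j == i))%:R * (a i j * ((i \in o.2) && (j \in o.2))%:R))).
  apply: eq_mean => o; rewrite /gain ij /=.
  by case: (i \in _); case: (j \in _); case: (_ == j); case: (_ == i);
    rewrite /= ?mulr1 ?mulr0 ?mul1r ?mul0r.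
rewrite -[LHS]/(mean s (fun o => (fun c : {ffun T -> T} => ((c i == j) && (c j == i))%:R) o.1 *
  (fun W : {set T} => a i j * ((i \in W) && (j \in W))%:R) o.2)) (mean_indep _ _ sn).
have -> : \sum_W p W * (a i j * ((i \in W) && (j \in W))%:R) =
    a i j * \sum_(W : {set T} | (i \in W) && (j \in W)) p W.
  rewrite mulr_sumr [RHS]big_mkcond; apply: eq_bigr => W _.
  by case: ifP => _ /=; rewrite ?mulr1 ?mulr0 // mulrC.
have -> : \sum_(c : {ffun T -> T}) (\prod_i choice_w adj s i (c i)) * ((c i == j) && (c j == i))%:R
   = choice_w adj s i j * choice_w adj s j i.
  (* [F] writes the two indicators into rows [i] and [j], so that the sum over all choice functions
     becomes a product of row sums; every other row sums to 1. *)
  pose F k l := choice_w adj s k l * ((k == i) ==> (l == j))%:R * ((k == j) ==> (l == i))%:R.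
  transitivity (\sum_(c : {ffun T -> T}) \prod_k F k (c k)).
    apply: eq_bigr => c _; rewrite /F !big_split /= -mulrA; congr (_ * _).
    rewrite (bigD1 i)//= eqxx big1 => [|k /negPf -> //].
    rewrite [X in _ = _ * X](bigD1 j)//= eqxx big1 => [|k /negPf -> //].
    by rewrite !mulr1 /=; do 2 case: eqP => _; rewrite ?mulr1 ?mulr0.
  rewrite -(bigA_distr_bigA F) (bigD1 i)//= [X in _ * X](bigD1 j)//= mulrA.
  rewrite [X in _ * X]big1 ?mulr1 => [|k /andP[/negPf ki /negPf kj]].
    congr (_ * _).
      rewrite (bigD1 j)//= big1 => [|l /negPf lj].
        by rewrite /F !eqxx (negPf neq_ij) /= !mulr1 addr0.
      by rewrite /F eqxx lj /= mulr0 mul0r.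
    rewrite (bigD1 i)//= big1 => [|l /negPf lj].
      by rewrite /F !eqxx (negPf neq_ji) /= !mulr1 addr0.
    by rewrite /F eqxx lj /= mulr0.
  rewrite -[RHS](choice_w_sum k sn); apply: eq_bigr => l _.
  by rewrite /F ki kj /= !mulr1.
rewrite /choice_w !gt_eqF// ij ji (admC sn j i).
by field; rewrite !gt_eqF.
Qed.

Definition rowrate s i : R := (\sum_j rate s i j * s (i, j)) / rowsum s i.

Definition relgain s o i : R := gainsum o i / rowsum s i.

Definition total_weight : R := \sum_i \sum_j weight i j.

(** An isolated vertex has initial strength 0 and contributes 0, the inverse of 0 being 0. *)
Definition relgain_bound : R := gain_bound * \sum_i (rowsum v0 i)^-1.

Definition total_rate s : R := \sum_i \sum_j rate s i j * s (i, j).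

Definition inv_strength s : R := \sum_i (rowsum s i)^-1.

(** This is [(m - u)^2 / (m + u)] with [m = r X] and [u = X / t], after cancelling [X / t]; the
    denominator is thus positive even where [X = 0]. *)
Definition edge_excess (t : R) s i j : R :=
  s (i, j) / t * (t * rate s i j - 1) ^+ 2 / (t * rate s i j + 1).

Definition excess (n : nat) s : R := \sum_i \sum_j edge_excess n.+1%:R s i j.

(** * Drift of the Lyapunov function *)

Lemma rateC n s i j : admissible n s -> rate s i j = rate s j i.
Proof. by move=> sn; rewrite /rate weightC (admC sn) [rowsum s i * _]mulrC. Qed.

Lemma rate_ge0 n s i j : admissible n s -> 0 <= rate s i j.
Proof.
move=> sn; apply: divr_ge0; apply: mulr_ge0; rewrite ?weight_ge0//;
  [exact: admissible_ge0 sn _|exact: rowsum_ge0 sn _|exact: rowsum_ge0 sn _].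
Qed.

Lemma weight_le i j : weight i j <= total_weight.
Proof.
rewrite /total_weight (bigD1 i)//= (bigD1 j)//= -addrA lerDl addr_ge0//.
  by apply: sumr_ge0 => l _; exact: weight_ge0.
by apply: sumr_ge0 => k _; apply: sumr_ge0 => l _; exact: weight_ge0.
Qed.

Lemma weight_nadj i j : ~~ adj i j -> weight i j = 0.
Proof. by move=> nij; apply/eqP; rewrite eq_le weight_ge0 andbT leNgt; apply: contra nij => /weight_adj. Qed.

Lemma rate_nadj s i j : ~~ adj i j -> rate s i j = 0.
Proof. by move=> nij; rewrite /rate weight_nadj// !mul0r. Qed.

Lemma rowsum_gt0 n s i j : admissible n s -> adj i j -> 0 < rowsum s i.
Proof.
by move=> sn ij; rewrite (lt_le_trans (admissible_gt0 sn ij))// (admissible_le_rowsum sn).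
Qed.

Lemma rate_le_weight n s i j : admissible n s -> rate s i j * s (i, j) <= weight i j.
Proof.
move=> sn; case: (boolP (adj i j)) => [ij|nij]; last first.
  by rewrite rate_nadj// mul0r weight_ge0.
have ji : adj j i by rewrite -adjC.
have Yi := rowsum_gt0 sn ij; have Yj := rowsum_gt0 sn ji.
have -> : rate s i j * s (i, j) =
    weight i j * ((s (i, j) / rowsum s i) * (s (j, i) / rowsum s j)).
  by rewrite (admC sn j i) /rate; field; rewrite !gt_eqF.
rewrite -[leRHS]mulr1 ler_wpM2l ?weight_ge0//.
apply: mulr_ile1; rewrite ?ler_pdivrMr// ?mul1r ?(admissible_le_rowsum sn)//.
  by rewrite divr_ge0 ?(admissible_ge0 sn)// ltW.
by rewrite divr_ge0 ?(admissible_ge0 sn)// ltW.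
Qed.

Lemma gainsum_eq0 n s o i : admissible n s -> rowsum s i = 0 -> gainsum o i = 0.
Proof.
move=> sn Y0; apply: big1 => j _; case: (boolP (adj i j)) => [ij|/gain_nadj//].
by have := rowsum_gt0 sn ij; rewrite Y0 ltxx.
Qed.

Lemma rowsum_v0_le n s i : admissible n s -> rowsum v0 i <= rowsum s i.
Proof. by move=> sn; apply: ler_sum => j _; exact: adm_ge sn _. Qed.

Lemma rowsum_v0_ge0 i : 0 <= rowsum v0 i.
Proof. exact: sumr_ge0. Qed.

Lemma relgain_bound_ge0 : 0 <= relgain_bound.
Proof.
apply: mulr_ge0; first exact: le_trans gain_bound_ge1.
by apply: sumr_ge0 => i _; rewrite invr_ge0 rowsum_v0_ge0.
Qed.

(** * Relative gains of the vertices *)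

Lemma relgain_ge0 n s o i : admissible n s -> 0 <= relgain s o i.
Proof. by move=> sn; apply: divr_ge0; [exact: gainsum_ge0|exact: rowsum_ge0 sn _]. Qed.

Lemma rowsum_v0_gt0 n s i : admissible n s -> rowsum s i != 0 -> 0 < rowsum v0 i.
Proof.
move=> sn Y0; rewrite lt_neqAle rowsum_v0_ge0 andbT eq_sym; apply: contra Y0 => /eqP v00.
apply/eqP; apply: big1 => j _; case: (boolP (adj i j)) => [/v0_adj|/(adm_nadj sn)//].
rewrite lt_neqAle => /andP[+ _]; apply: contraNeq => _; rewrite eq_sym.
by move/eqP: v00; rewrite psumr_eq0// => /allP/(_ j); rewrite mem_index_enum => /(_ isT).
Qed.

Lemma relgain_le n s o i : admissible n s -> relgain s o i <= relgain_bound.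
Proof.
move=> sn; have [Y0|Y0] := eqVneq (rowsum s i) 0.
  by rewrite /relgain Y0 invr0 mulr0 relgain_bound_ge0.
have v0i := rowsum_v0_gt0 sn Y0.
rewrite /relgain /relgain_bound; apply: ler_pM.
- exact: gainsum_ge0.
- by rewrite invr_ge0 (rowsum_ge0 sn).
- exact: gainsum_le.
rewrite (bigD1 i)//=; apply: (@le_trans _ _ (rowsum v0 i)^-1).
  rewrite lef_pV2 ?posrE// ?(rowsum_v0_le _ sn)//.
  exact: lt_le_trans (rowsum_v0_le _ sn).
by rewrite lerDl sumr_ge0// => k _; rewrite invr_ge0 rowsum_v0_ge0.
Qed.

(* Each jump of a vertex of strength [Y] costs [O(1/Y^2)] in the Taylor
   expansions, and is paid for by the decrease of [1/Y]. *)
Lemma relgain_sqr_le n s o i : admissible n s ->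
  relgain s o i ^+ 2 <= gain_bound * (1 + relgain_bound) *
    ((rowsum s i)^-1 - (rowsum (next s o) i)^-1).
Proof.
move=> sn; rewrite rowsum_next; have [Y0|Y0] := eqVneq (rowsum s i) 0.
  by rewrite /relgain (gainsum_eq0 o sn Y0) Y0 addr0 subrr mul0r expr0n mulr0.
have rb := relgain_le o i sn; move: rb; rewrite /relgain.
have {Y0} Y0 : 0 < rowsum s i by rewrite lt_neqAle eq_sym Y0 (rowsum_ge0 sn).
have := gainsum_ge0 o i; have := gainsum_le o i; have := gain_bound_ge1.
move: (gainsum o i) (rowsum s i) Y0 gain_bound relgain_bound => y Y Y0 A k A1 yA y0 yk.
have Yy : 0 < Y + y by rewrite ltr_pwDl.
have -> : A * (1 + k) * (Y^-1 - (Y + y)^-1) =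
    (y / Y) ^+ 2 + (A * (1 + k) * Y - y * (Y + y)) * y / (Y ^+ 2 * (Y + y)).
  by field; rewrite !gt_eqF.
rewrite lerDl; apply: divr_ge0; last by rewrite mulr_ge0// ?sqr_ge0// ltW.
apply: mulr_ge0 => //; rewrite subr_ge0.
have ykY : y <= k * Y by rewrite -ler_pdivrMr.
have -> : A * (1 + k) * Y = A * (Y + k * Y) by ring.
apply: ler_pM => //; [exact: ltW|by rewrite lerD2l].
Qed.

Lemma mean_relgain n s i : admissible n s -> mean s (fun o => relgain s o i) = rowrate s i.
Proof.
move=> sn; rewrite /relgain /rowrate.
rewrite (@eq_mean s _ (fun o => (rowsum s i)^-1 * gainsum o i)) => [|o]; last exact: mulrC.
rewrite meanZ mulrC; congr (_ * _).
rewrite (mean_sum s (fun j o => gain o i j)); apply: eq_bigr => j _.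
exact: mean_gain sn.
Qed.

Lemma rowrate_ge0 n s i : admissible n s -> 0 <= rowrate s i.
Proof.
move=> sn; apply: divr_ge0; last exact: rowsum_ge0 sn _.
by apply: sumr_ge0 => j _; apply: mulr_ge0; [exact: rate_ge0 sn|exact: admissible_ge0 sn _].
Qed.

(** [rowrate s i] is the average of [rate s i j] over [j] with weights [s (i, j)]; at strength 0 all
    these weights vanish. *)
Lemma rowsum_rate_dev n s i : admissible n s ->
  \sum_j s (i, j) * (rate s i j - rowrate s i) = 0.
Proof.
move=> sn; under eq_bigr do rewrite mulrBr.
rewrite sumrB -mulr_suml -/(rowsum s i) /rowrate.
have [Y0|Y0] := eqVneq (rowsum s i) 0; last first.
  rewrite mulrCA divff// mulr1; apply/eqP; rewrite subr_eq0; apply/eqP.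
  by apply: eq_bigr => j _; rewrite mulrC.
rewrite Y0 mul0r subr0; apply: big1 => j _.
have := admissible_le_rowsum sn i j; rewrite Y0 => X0.
by rewrite (@le_anti _ _ (s (i, j)) 0) ?mul0r// X0 (admissible_ge0 sn).
Qed.

Definition dissipation s : R := \sum_i \sum_j s (i, j) * (rate s i j - rowrate s i) ^+ 2.

(** Symmetry in [i] and [j] reduces the sum to twice its half centred at [i]; then [rowsum_rate_dev]
    allows [h (r_i) r_i], constant in [j], to be subtracted. The left-hand side is the shape in
    which drifts appear, and the right-hand side is comparable to [dissipation]. *)
Lemma sum_rate_dev n s (h : R -> R) : admissible n s ->
  \sum_i \sum_j h (rate s i j) * (rate s i j * s (i, j)) *
     (2 * rate s i j - rowrate s i - rowrate s j) =
  2 * \sum_i \sum_j s (i, j) * (rate s i j - rowrate s i) *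
     (h (rate s i j) * rate s i j - h (rowrate s i) * rowrate s i).
Proof.
move=> sn; pose f i j := h (rate s i j) * (rate s i j * s (i, j)) * (rate s i j - rowrate s i).
transitivity (\sum_i \sum_j f i j + \sum_i \sum_j f j i).
  rewrite -big_split; apply: eq_bigr => i _; rewrite -big_split; apply: eq_bigr => j _.
  by rewrite /f /= (rateC j i sn) (admC sn j i); ring.
rewrite [X in _ + X]exchange_big -mulr2n -[LHS]mulr_natl; congr (_ * _).
apply: eq_bigr => i _; apply/eqP; rewrite -subr_eq0 -sumrB; apply/eqP.
transitivity (h (rowrate s i) * rowrate s i * \sum_j s (i, j) * (rate s i j - rowrate s i)).
  rewrite mulr_sumr.
  by apply: eq_bigr => j _; rewrite /f; ring.
by rewrite (rowsum_rate_dev i sn) mulr0.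
Qed.

Lemma sum_rate_dev1 n s : admissible n s ->
  \sum_i \sum_j rate s i j * s (i, j) * (2 * rate s i j - rowrate s i - rowrate s j) =
  2 * dissipation s.
Proof.
move=> sn; transitivity (\sum_i \sum_j 1 * (rate s i j * s (i, j)) *
  (2 * rate s i j - rowrate s i - rowrate s j)).
  by do 2 (apply: eq_bigr => ? _); rewrite mul1r.
rewrite (sum_rate_dev (fun=> 1) sn); congr (_ * _).
by do 2 (apply: eq_bigr => ? _); ring.
Qed.

Lemma sum_damped_rate_dev n s (t : R) : admissible n s -> 0 <= t ->
  \sum_i \sum_j (1 - 4 / (1 + t * rate s i j) ^+ 2) * (rate s i j * s (i, j)) *
     (2 * rate s i j - rowrate s i - rowrate s j) <= 4 * dissipation s.
Proof.
move=> sn t0; rewrite (sum_rate_dev (fun r => 1 - 4 / (1 + t * r) ^+ 2) sn).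
have -> : 4 * dissipation s = 2 * \sum_i \sum_j s (i, j) * (2 * (rate s i j - rowrate s i) ^+ 2).
  rewrite (_ : 4 = 2 * 2 :> R); last by rewrite -natrM.
  rewrite -mulrA; congr (_ * _); rewrite mulr_sumr; apply: eq_bigr => i _.
  by rewrite mulr_sumr; apply: eq_bigr => j _; rewrite mulrCA.
apply: ler_wpM2l => //; apply: ler_sum => i _; apply: ler_sum => j _.
rewrite -mulrA; apply: ler_wpM2l; first exact: admissible_ge0 sn _.
apply: damped_rate_lipschitz => //; [exact: rate_ge0 sn|exact: rowrate_ge0 sn].
Qed.

Lemma dissipation_ge0 n s : admissible n s -> 0 <= dissipation s.
Proof.
move=> sn; apply: sumr_ge0 => i _; apply: sumr_ge0 => j _.
by apply: mulr_ge0; [exact: admissible_ge0 sn _|exact: sqr_ge0].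
Qed.

(** Summed over ordered pairs, the term [- 2 m] has drift about [- 4 D], which cancels the [4 D]
    that jumps may add to the excess. *)
Definition edge_lyapunov (t : R) s i j : R :=
  edge_excess t s i j - 2 * (rate s i j * s (i, j)).

(** Here [m] has a negative coefficient and the harmonic term a positive one, so the lower bound
    [match_rate_increment] and the upper bound [potential_increment] both point the right way. *)
Lemma edge_lyapunovE n s i j (t : R) : admissible n s -> 0 < t ->
  edge_lyapunov t s i j =
  - (rate s i j * s (i, j)) - 3 * (s (i, j) / t) + 4 * (s (i, j) / t / (1 + t * rate s i j)).
Proof.
move=> sn t0; rewrite /edge_lyapunov /edge_excess excess_split//; last exact: rate_ge0 sn.
by ring.
Qed.

(** The bound is affine in the gain, the two relative gains and their squares, ready for
    [mean_affine]. The coefficient [4 + relgain_bound] is [2 + relgain_bound] from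
    [match_rate_increment] plus 2 from the product of relative gains in [potential_increment]. *)
Lemma edge_lyapunov_next n s o i j (t r l m u w : R) :
  admissible n s -> admissible n.+1 (next s o) ->
  t = n.+1%:R -> r = rate s i j -> l = (1 + t * r) ^- 2 ->
  m = r * s (i, j) -> u = s (i, j) / t -> w = weight i j ->
  edge_lyapunov (t + 1) (next s o) i j <=
  (edge_lyapunov t s i j + 3 * u / (t + 1) - 4 * l * u / (t + 1) - 8 * l * m / (t + 1)
    + 4 * w * (t + 1) ^- 2)
  + ((- 2 * r - 3 / (t + 1) + 4 * l / (t + 1)) * gain o i j
  + ((m + 4 * l * m) * relgain s o i + ((m + 4 * l * m) * relgain s o j
  + w * (4 + relgain_bound) * (relgain s o i ^+ 2 + relgain s o j ^+ 2)))).
Proof.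
move=> sn sn' tE rE lE mE uE wE.
have t0 : 0 < t by rewrite tE ltr0n.
have kap0 := relgain_bound_ge0.
have w0 : 0 <= w by rewrite wE weight_ge0.
have t10 : 0 < t + 1 by pos.
rewrite (edge_lyapunovE i j sn t0) (edge_lyapunovE i j sn' t10).
case: (boolP (adj i j)) => [ij|nij]; last first.
  have X0 : s (i, j) = 0 by exact: adm_nadj sn _ _ nij.
  have X'0 : next s o (i, j) = 0 by exact: adm_nadj sn' _ _ nij.
  have w00 : w = 0 by rewrite wE weight_nadj.
  have r00 : r = 0 by rewrite rE rate_nadj.
  have m00 : m = 0 by rewrite mE X0 mulr0.
  have u00 : u = 0 by rewrite uE X0 mul0r.
  rewrite X'0 X0 gain_nadj// !rate_nadj// w00 r00 m00 u00 ?(mul0r, mulr0).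
  by lra.
have ji : adj j i by rewrite -adjC.
have X0 := admissible_gt0 sn ij.
have XY := admissible_le_rowsum sn i j.
have XZ : s (i, j) <= rowsum s j by rewrite (admC sn) (admissible_le_rowsum sn).
have xy := gain_le_sum o i j.
have xz : gain o i j <= gainsum o j by rewrite gainC gain_le_sum.
have M := match_rate_increment w0 kap0 X0 XY XZ (gain_ge0 o i j) xy xz
  (relgain_le o i sn) (relgain_le o j sn).
have G := potential_increment w0 X0 (rowsum_gt0 sn ij) (rowsum_gt0 sn ji)
  (gain_ge0 o i j) (gainsum_ge0 o i) (gainsum_ge0 o j) t0.
have rE' : w * s (i, j) / (rowsum s i * rowsum s j) = r by rewrite rE wE.
have r'E : w * (s (i, j) + gain o i j) / ((rowsum s i + gainsum o i) * (rowsum s j + gainsum o j))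
   = rate (next s o) i j by rewrite wE /rate !rowsum_next nextE.
rewrite nextE.
move: M G; rewrite rE' r'E -/(relgain s o i) -/(relgain s o j) -rE -?mE -?lE -?uE.
have r0 : 0 <= r by rewrite rE; exact: rate_ge0 sn.
have l01 : 0 <= l <= 1.
  rewrite lE invr_ge0 sqr_ge0/= invf_le1 ?exprn_gt0//; last by pos.
  by rewrite exprn_ege1// lerDl mulr_ge0// ltW.
have m0w : 0 <= m <= w.
  by rewrite mE mulr_ge0 ?(admissible_ge0 sn)//= wE rE (rate_le_weight i j sn).
move: (relgain_ge0 o i sn) (relgain_ge0 o j sn) kap0 w0 l01 m0w.
move: (rate (next s o) i j * (s (i, j) + gain o i j)).
move: ((s (i, j) + gain o i j) / (t + 1) / (1 + (t + 1) * rate (next s o) i j)) => G' M'.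
have -> : (s (i, j) + gain o i j) / (t + 1) = u + (gain o i j - u) / (t + 1).
  by rewrite uE; field; rewrite !gt_eqF.
move: (u / (1 + t * r)) => G.
move: (relgain s o i) (relgain s o j) relgain_bound (gain o i j) => e f k x.
have := invr_ge0 (t + 1); rewrite (ltW t10) -exprVn; move: (t + 1)^-1 => g g0.
clear -g0.
move=> e0 f0 k0 w0 /andP[l0 l1] /andP[m0 mw] HM HG.
have lm0 : 0 <= l * m by exact: mulr_ge0.
have lmw : l * m <= w by apply: le_trans mw; rewrite ler_piMl.
(* The product term carries a factor 4, hence contributes [2 w (e^2 + f^2)]. *)
have a1 : l * m * (e * f) <= w * ((e ^+ 2 + f ^+ 2) / 2).
  apply: ler_pM => //; first exact: mulr_ge0.
  by have := sqr_ge0 (e - f); nra.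
have a2 : l * m * g ^+ 2 <= w * g ^+ 2 by rewrite ler_wpM2r// sqr_ge0.
move: HG; rewrite [_ * l]mulrDl [m * _ * l]mulrC mulrA.
nra.
Qed.

Lemma mean_affine n s (f1 f2 f3 f4 : outcome -> R) (c0 c1 c2 c3 c4 : R) :
  admissible n s ->
  mean s (fun o => c0 + (c1 * f1 o + (c2 * f2 o + (c3 * f3 o + c4 * f4 o)))) =
  c0 + (c1 * mean s f1 + (c2 * mean s f2 + (c3 * mean s f3 + c4 * mean s f4))).
Proof.
move=> sn; rewrite (meanD s (fun=> c0)) (mean_cst c0 sn); congr (_ + _).
rewrite (meanD s (fun o => c1 * f1 o)) meanZ; congr (_ + _).
rewrite (meanD s (fun o => c2 * f2 o)) meanZ; congr (_ + _).
by rewrite (meanD s (fun o => c3 * f3 o)) !meanZ.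
Qed.

Lemma mean_ge0 n s (f : outcome -> R) : admissible n s -> (forall o, 0 <= f o) -> 0 <= mean s f.
Proof.
by move=> sn f0; apply: sumr_ge0 => o _; apply: mulr_ge0; [exact: outcome_prob_ge0 sn|].
Qed.

Lemma total_weight_ge0 : 0 <= total_weight.
Proof. by apply: sumr_ge0 => i _; apply: sumr_ge0 => j _; exact: weight_ge0. Qed.

(** The jump terms are grouped as multiples of [2 r - r_i - r_j]: first those of the excess, then
    those of [- 2 m]. The rest is [time_drift_le]; the constant 20 is its 16 plus the 4 of
    [edge_lyapunov_next]. *)
Lemma mean_edge_lyapunov n s i j (t : R) :
  admissible n s -> (forall o, 0 < p o.2 -> admissible n.+1 (next s o)) -> t = n.+1%:R ->
  mean s (fun o => edge_lyapunov (t + 1) (next s o) i j) <=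
  edge_lyapunov t s i j - edge_excess t s i j / (t + 1)
  + (1 - 4 / (1 + t * rate s i j) ^+ 2) * (rate s i j * s (i, j)) *
     (2 * rate s i j - rowrate s i - rowrate s j)
  - 2 * (rate s i j * s (i, j) * (2 * rate s i j - rowrate s i - rowrate s j))
  + total_weight * (4 + 2 * relgain_bound) * mean s (fun o => relgain s o i ^+ 2 + relgain s o j ^+ 2)
  + 20 * total_weight * (t + 1) ^- 2.
Proof.
move=> sn sn' tE; have t1 : 1 <= t by rewrite tE ler1n.
have step o (po : 0 < p o.2) :=
  @edge_lyapunov_next n s o i j t _ _ _ _ _ sn (sn' o po) tE erefl erefl erefl erefl erefl.
apply: le_trans (mean_le sn step) _.
rewrite (mean_affine _ _ _ _ _ _ _ _ _ sn) (mean_gain _ _ sn) !(mean_relgain _ sn).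
have X0 := admissible_ge0 sn (i, j); have r0 := rate_ge0 i j sn.
have D := time_drift_le X0 t1 r0; move: D; rewrite -/(edge_excess t s i j).
have g0 : 0 <= (t + 1) ^- 2 by rewrite invr_ge0 sqr_ge0.
have q0 : 0 <= mean s (fun o => relgain s o i ^+ 2 + relgain s o j ^+ 2).
  by apply: (mean_ge0 sn) => o; rewrite addr_ge0 ?sqr_ge0.
have w1 : weight i j * (t + 1) ^- 2 <= total_weight * (t + 1) ^- 2.
  by rewrite ler_wpM2r// weight_le.
have w2 : weight i j * (4 + relgain_bound) * mean s (fun o => relgain s o i ^+ 2 + relgain s o j ^+ 2)
   <= total_weight * (4 + 2 * relgain_bound) * mean s (fun o => relgain s o i ^+ 2 + relgain s o j ^+ 2).
  apply: ler_wpM2r => //; have k0 := relgain_bound_ge0.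
  by apply: ler_pM; rewrite ?weight_ge0 ?weight_le//; lra.
have w3 : rate s i j * s (i, j) * (t + 1) ^- 2 <= weight i j * (t + 1) ^- 2.
  by rewrite ler_wpM2r// (rate_le_weight i j sn).
move: w1 w2 w3; move: (mean _ _) => q.
move: (edge_lyapunov t s i j) (edge_excess _ _ _ _) (rowrate s i) (rowrate s j) => L e Ri Rj.
move: (weight i j) total_weight relgain_bound => w tw k.
move: (rate s i j) (s (i, j)) => r X.
move: ((t + 1) ^- 2) (t + 1)^-1 ((1 + t * r) ^- 2) => g2 g l.
lra.
Qed.

Definition sqgain s o : R := \sum_i relgain s o i ^+ 2.

Definition lyapunov (t : R) s : R := \sum_i \sum_j edge_lyapunov t s i j.

(** [4 + 2 * relgain_bound] is twice the factor [2 + relgain_bound] of [edge_rate_next], so one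
    constant serves both [mean_lyapunov] and [mean_total_rate]. *)
Definition sqgain_coef : R := total_weight * (4 + 2 * relgain_bound) * (2 * #|T|%:R).

Definition time_coef : R := 20 * total_weight * #|T|%:R ^+ 2.

Lemma sum_relgain_sqr s o :
  \sum_i \sum_j (relgain s o i ^+ 2 + relgain s o j ^+ 2) = 2 * #|T|%:R * sqgain s o.
Proof.
transitivity (\sum_i (#|T|%:R * relgain s o i ^+ 2 + sqgain s o)).
  by apply: eq_bigr => i _; rewrite big_split sumr_const /= (mulr_natl _ #|T|).
rewrite big_split -mulr_sumr sumr_const /= -[X in _ + X]mulr_natl -/(sqgain s o).
by rewrite -[LHS]mulr2n -[LHS](mulr_natl _ 2) mulrA.
Qed.

Lemma mean_lyapunov n s (t : R) :
  admissible n s -> (forall o, 0 < p o.2 -> admissible n.+1 (next s o)) -> t = n.+1%:R ->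
  mean s (fun o => lyapunov (t + 1) (next s o)) <=
  lyapunov t s - excess n s / (t + 1) + sqgain_coef * mean s (sqgain s)
   + time_coef * (t + 1) ^- 2.
Proof.
move=> sn sn' tE; rewrite /lyapunov.
rewrite (mean_sum s (fun i o => \sum_j edge_lyapunov (t + 1) (next s o) i j)).
under eq_bigr do rewrite (mean_sum s (fun j o => edge_lyapunov (t + 1) (next s o) _ j)).
apply: (@le_trans _ _ (\sum_i \sum_j _)).
  by apply: ler_sum => i _; apply: ler_sum => j _; exact: mean_edge_lyapunov sn sn' tE.
do 5 (under eq_bigr do rewrite big_split /=; rewrite big_split /=).
have -> : \sum_i \sum_j total_weight * (4 + 2 * relgain_bound) *
    mean s (fun o => relgain s o i ^+ 2 + relgain s o j ^+ 2) = sqgain_coef * mean s (sqgain s).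
  under eq_bigr do rewrite -mulr_sumr.
  rewrite -mulr_sumr.
  under eq_bigr do rewrite -(mean_sum s (fun j o => relgain s o _ ^+ 2 + relgain s o j ^+ 2)).
  rewrite -(mean_sum s (fun i o => \sum_j (relgain s o i ^+ 2 + relgain s o j ^+ 2))).
  by rewrite (eq_mean s (sum_relgain_sqr s)) meanZ /sqgain_coef !mulrA.
have -> : \sum_(i : T) \sum_(j : T) 20 * total_weight * (t + 1) ^- 2 = time_coef * (t + 1) ^- 2.
  rewrite sumr_const -[LHS]mulr_natr sumr_const -[X in X * _]mulr_natr /time_coef.
  by move: (#|T|%:R : R) (_ ^- 2) => k g; ring.
rewrite !lerD2r.
have -> : \sum_i \sum_j - (edge_excess t s i j / (t + 1)) = - (excess n s / (t + 1)).
  rewrite /excess -tE mulr_suml -sumrN; apply: eq_bigr => i _.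
  by rewrite mulr_suml -sumrN.
(* What remains is the damped sum, at most [4 D], minus [4 D]. *)
rewrite -!addrA lerD2l gerDl.
have := sum_damped_rate_dev sn (_ : 0 <= t); rewrite tE ler0n => /(_ isT); rewrite -tE.
have -> : \sum_i \sum_j - (2 * (rate s i j * s (i, j) * (2 * rate s i j - rowrate s i - rowrate s j)))
   = - (4 * dissipation s).
  rewrite (_ : 4 = 2 * 2 :> R); last by rewrite -natrM.
  rewrite -mulrA -(sum_rate_dev1 sn) mulr_sumr -sumrN; apply: eq_bigr => i _.
  by rewrite mulr_sumr -sumrN.
by rewrite subr_le0.
Qed.

(** * Drift of the total rate and compensation of the errors *)

Lemma edge_rate_next n s o i j : admissible n s -> admissible n.+1 (next s o) ->
  rate s i j * s (i, j) + (2 * rate s i j * gain o i j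
   + (- (rate s i j * s (i, j)) * relgain s o i + (- (rate s i j * s (i, j)) * relgain s o j
   + - (total_weight * (2 + relgain_bound)) * (relgain s o i ^+ 2 + relgain s o j ^+ 2)))) <=
  rate (next s o) i j * next s o (i, j).
Proof.
move=> sn sn'; have kap0 := relgain_bound_ge0.
have q0 : 0 <= relgain s o i ^+ 2 + relgain s o j ^+ 2 by rewrite addr_ge0 ?sqr_ge0.
have wq0 : weight i j * ((2 + relgain_bound) * (relgain s o i ^+ 2 + relgain s o j ^+ 2)) <=
    total_weight * (2 + relgain_bound) * (relgain s o i ^+ 2 + relgain s o j ^+ 2).
  by rewrite mulrA ler_wpM2r// ler_wpM2r ?weight_le// addr_ge0.
case: (boolP (adj i j)) => [ij|nij]; last first.
  rewrite !rate_nadj// !(mul0r, mulr0, oppr0, add0r) mulNr oppr_le0.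
  by apply: le_trans wq0; rewrite weight_nadj// mul0r.
have ji : adj j i by rewrite -adjC.
have XZ : s (i, j) <= rowsum s j by rewrite (admC sn) (admissible_le_rowsum sn).
have xz : gain o i j <= gainsum o j by rewrite gainC gain_le_sum.
have := match_rate_increment (weight_ge0 i j) kap0 (admissible_gt0 sn ij)
  (admissible_le_rowsum sn i j) XZ (gain_ge0 o i j) (gain_le_sum o i j) xz
  (relgain_le o i sn) (relgain_le o j sn).
rewrite /= -/(rate s i j) -/(relgain s o i) -/(relgain s o j) -nextE -!rowsum_next -/(rate (next s o) i j).
by apply: le_trans; lra.
Qed.

(** Up to second-order terms the drift of [total_rate] is [2 * dissipation]; only its sign is kept
    here. *)
Lemma mean_total_rate n s :
  admissible n s -> (forall o, 0 < p o.2 -> admissible n.+1 (next s o)) ->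
  2 * total_rate s - sqgain_coef * mean s (sqgain s) <=
  2 * mean s (fun o => total_rate (next s o)).
Proof.
move=> sn sn'; rewrite /total_rate.
rewrite (mean_sum s (fun i o => \sum_j rate (next s o) i j * next s o (i, j))).
under [in leRHS]eq_bigr do
  rewrite (mean_sum s (fun j o => rate (next s o) _ j * next s o (_, j))).
apply: (@le_trans _ _ (2 * \sum_i \sum_j (rate s i j * s (i, j)
   + rate s i j * s (i, j) * (2 * rate s i j - rowrate s i - rowrate s j)
   - total_weight * (2 + relgain_bound) *
     mean s (fun o => relgain s o i ^+ 2 + relgain s o j ^+ 2)))); last first.
  apply: ler_wpM2l => //; apply: ler_sum => i _; apply: ler_sum => j _.
  have step o (po : 0 < p o.2) := edge_rate_next i j sn (sn' o po).
  apply: le_trans (mean_le sn step).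
  rewrite (mean_affine _ _ _ _ _ _ _ _ _ sn) (mean_gain _ _ sn) !(mean_relgain _ sn).
  by move: (mean _ _) => q; lra.
do 2 (under [in leRHS]eq_bigr do rewrite big_split /=; rewrite big_split /=).
rewrite (sum_rate_dev1 sn).
have -> : \sum_i \sum_j - (total_weight * (2 + relgain_bound) *
    mean s (fun o => relgain s o i ^+ 2 + relgain s o j ^+ 2)) =
    - (total_weight * (2 + relgain_bound) * (2 * #|T|%:R) * mean s (sqgain s)).
  rewrite -(mulrA _ (2 * _)) -meanZ -(eq_mean s (sum_relgain_sqr s)).
  rewrite (mean_sum s (fun i o => \sum_j (relgain s o i ^+ 2 + relgain s o j ^+ 2))).
  rewrite mulr_sumr -sumrN; apply: eq_bigr => i _.
  rewrite (mean_sum s (fun j o => relgain s o i ^+ 2 + relgain s o j ^+ 2)).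
  by rewrite mulr_sumr -sumrN.
have := dissipation_ge0 sn; rewrite /sqgain_coef.
move: (#|T|%:R : R) (mean _ _) (\sum_i _) => k q S.
by lra.
Qed.

Definition jump_coef : R := sqgain_coef * (gain_bound * (1 + relgain_bound)).

(* A bounded submartingale whose increments dominate those of [excess]. *)
Definition payoff (n : nat) s : R :=
  2 * total_rate s - jump_coef * inv_strength s - time_coef / n.+1%:R.

Lemma sqgain_coef_ge0 : 0 <= sqgain_coef.
Proof.
have := relgain_bound_ge0; have := total_weight_ge0.
by rewrite /sqgain_coef => t0 r0; rewrite !mulr_ge0// addr_ge0// mulr_ge0.
Qed.

Lemma time_coef_ge0 : 0 <= time_coef.
Proof. by rewrite /time_coef mulr_ge0 ?sqr_ge0// mulr_ge0// total_weight_ge0. Qed.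

Lemma mean_sqgain n s : admissible n s ->
  (forall o, 0 < p o.2 -> admissible n.+1 (next s o)) ->
  sqgain_coef * mean s (sqgain s) <=
  jump_coef * (inv_strength s - mean s (fun o => inv_strength (next s o))).
Proof.
move=> sn sn'; rewrite /jump_coef -mulrA; apply: ler_wpM2l; first exact: sqgain_coef_ge0.
have -> : inv_strength s - mean s (fun o => inv_strength (next s o)) =
    mean s (fun o => inv_strength s + -1 * inv_strength (next s o)).
  by rewrite (meanD s (fun=> _)) (mean_cst _ sn) meanZ mulN1r.
rewrite -meanZ; apply: (mean_le sn) => o _.
rewrite mulN1r /inv_strength -sumrB mulr_sumr; apply: ler_sum => i _.
exact: relgain_sqr_le sn.
Qed.

(** Turns the time errors into a telescoping difference, which the last term of [payoff] absorbs. *)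
Lemma inv_time_step n : (n.+2%:R : R) ^- 2 <= n.+1%:R^-1 - n.+2%:R^-1.
Proof.
have -> : (n.+2%:R : R) = n.+1%:R + 1 by rewrite natr1.
have : (0 : R) < n.+1%:R by rewrite ltr0n.
move: (n.+1%:R : R) => t t0; have t10 : 0 < t + 1 by pos.
rewrite -subr_ge0.
have -> : t^-1 - (t + 1)^-1 - (t + 1) ^- 2 = (t * (t + 1) ^+ 2)^-1.
  by field; rewrite !gt_eqF.
pos.
Qed.

Lemma mean_payoffE n s : admissible n s ->
  mean s (fun o => payoff n.+1 (next s o)) =
  2 * mean s (fun o => total_rate (next s o))
  - jump_coef * mean s (fun o => inv_strength (next s o)) - time_coef / n.+2%:R.
Proof.
move=> sn; transitivity (mean s (fun o => 2 * total_rate (next s o) +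
    (- jump_coef * inv_strength (next s o) + - time_coef / n.+2%:R))).
  by apply: eq_mean => o; rewrite /payoff addrA !mulNr.
by rewrite !meanD !meanZ (mean_cst _ sn) addrA !mulNr.
Qed.

Lemma payoff_le_mean n s :
  admissible n s -> (forall o, 0 < p o.2 -> admissible n.+1 (next s o)) ->
  payoff n s <= mean s (fun o => payoff n.+1 (next s o)).
Proof.
move=> sn sn'; rewrite (mean_payoffE sn) /payoff.
have := mean_total_rate sn sn'; have := mean_sqgain sn sn'.
have : time_coef / n.+2%:R <= time_coef / n.+1%:R.
  by rewrite ler_wpM2l ?time_coef_ge0// lef_pV2 ?posrE ?ltr0n// ler_nat.
move: (mean _ _) (mean _ _) (mean _ _) (_ / n.+2%:R) (_ / n.+1%:R) => ? ? ? ? ?.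
by lra.
Qed.

Lemma lyapunovE n s : lyapunov n.+1%:R s = excess n s - 2 * total_rate s.
Proof.
rewrite /lyapunov /excess /total_rate mulr_sumr -sumrB; apply: eq_bigr => i _.
by rewrite mulr_sumr -sumrB.
Qed.

(** The increment of [2 * total_rate], added back to that of [lyapunov], is not estimated but kept
    as part of the increment of [payoff]; the other two terms of [payoff] pay for the errors. *)
Lemma mean_excess n s :
  admissible n s -> (forall o, 0 < p o.2 -> admissible n.+1 (next s o)) ->
  mean s (fun o => excess n.+1 (next s o)) <=
  excess n s - excess n s / n.+2%:R
  + (mean s (fun o => payoff n.+1 (next s o)) - payoff n s).
Proof.
move=> sn sn'; rewrite (mean_payoffE sn) /payoff.
have := mean_lyapunov sn sn' erefl; rewrite natr1 lyapunovE.
have -> : mean s (fun o => lyapunov n.+2%:R (next s o)) =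
    mean s (fun o => excess n.+1 (next s o)) - 2 * mean s (fun o => total_rate (next s o)).
  rewrite -mulNr -meanZ -meanD; apply: eq_mean => o.
  by rewrite lyapunovE mulNr.
have := mean_sqgain sn sn'.
have := ler_wpM2l time_coef_ge0 (inv_time_step n).
move: (mean _ _) (mean _ _) (mean _ _) (mean _ _) => ? ? ? ?.
move: (n.+2%:R ^- 2) (n.+2%:R^-1) (n.+1%:R^-1) => ? ? ?.
by lra.
Qed.

Lemma edge_excess_ge0 n s (t : R) i j : admissible n s -> 0 <= t -> 0 <= edge_excess t s i j.
Proof.
move=> sn t0; have := rate_ge0 i j sn; have := admissible_ge0 sn (i, j) => X0 r0.
by rewrite /edge_excess; pos.
Qed.

Lemma excess_ge0 n m s : admissible n s -> 0 <= excess m s.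
Proof.
move=> sn; apply: sumr_ge0 => i _; apply: sumr_ge0 => j _.
by apply: edge_excess_ge0 sn _; rewrite ler0n.
Qed.

Lemma payoff_le n m s : admissible n s -> payoff m s <= 2 * total_weight.
Proof.
move=> sn; have : total_rate s <= total_weight.
  by apply: ler_sum => i _; apply: ler_sum => j _; exact: rate_le_weight sn.
have : 0 <= jump_coef * inv_strength s.
  apply: mulr_ge0; last by apply: sumr_ge0 => i _; rewrite invr_ge0 (rowsum_ge0 sn).
  have r0 := relgain_bound_ge0; have g0 : 0 <= gain_bound by exact: le_trans gain_bound_ge1.
  by apply: mulr_ge0; [exact: sqgain_coef_ge0|pos].
have : 0 <= time_coef / m.+1%:R by rewrite divr_ge0 ?time_coef_ge0// ler0n.
rewrite /payoff; move: (_ / m.+1%:R) => ?.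
by lra.
Qed.

(** * Iterated expectations *)

(** The transition operator of the chain; its [k]-th iterate gives the expectation of [f] after [k]
    steps from [s]. *)
Definition step_mean (f : arr R T -> R) s : R := mean s (fun o => f (next s o)).

Lemma reach_next n s o : reach n s -> 0 < p o.2 -> reach n.+1 (next s o).
Proof. by move=> sn po; exists s => //; exists o. Qed.

Lemma next_admissible n s o : reach n s -> 0 < p o.2 -> admissible n.+1 (next s o).
Proof. by move=> sn po; apply: reach_admissible; exact: reach_next. Qed.

Lemma iter_step_mean_le k n s (f g : arr R T -> R) : reach n s ->
  (forall s', reach (n + k)%N s' -> f s' <= g s') ->
  iter k step_mean f s <= iter k step_mean g s.
Proof.
elim: k n s => [|k IH] n s sn fg; first by apply: fg; rewrite addn0.
apply: mean_le (reach_admissible sn) _ => o po; apply: IH (reach_next sn po) _ => s'.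
by rewrite addSnnS; exact: fg.
Qed.

Lemma iter_step_meanD k (f g : arr R T -> R) s :
  iter k step_mean (fun s => f s + g s) s = iter k step_mean f s + iter k step_mean g s.
Proof.
elim: k s => // k IH s; rewrite !iterS /step_mean -meanD.
by apply: eq_mean => o; exact: IH.
Qed.

Lemma iter_step_meanZ k (c : R) (f : arr R T -> R) s :
  iter k step_mean (fun s => c * f s) s = c * iter k step_mean f s.
Proof.
elim: k s => // k IH s; rewrite !iterS /step_mean -meanZ.
by apply: eq_mean => o; exact: IH.
Qed.

Lemma iter_step_mean_cst k (c : R) n s : reach n s -> iter k step_mean (fun=> c) s = c.
Proof.
elim: k n s => // k IH n s sn; rewrite iterS -[RHS](mean_cst c (reach_admissible sn)).
apply/le_anti/andP; split; apply: mean_le (reach_admissible sn) _ => o po;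
  by rewrite (IH n.+1)//; exact: reach_next.
Qed.

Definition expected_excess n : R := iter n step_mean (excess n) v0.

Definition expected_payoff n : R := iter n step_mean (payoff n) v0.

Lemma reach0 : reach 0 v0. Proof. by []. Qed.

Lemma expected_payoff_nondecreasing n : expected_payoff n <= expected_payoff n.+1.
Proof.
rewrite /expected_payoff iterSr; apply: (iter_step_mean_le reach0) => s' sn.
by apply: payoff_le_mean => [|o po]; [exact: reach_admissible|exact: next_admissible].
Qed.

Lemma expected_payoff_le n : expected_payoff n <= 2 * total_weight.
Proof.
rewrite -[leRHS](iter_step_mean_cst n _ reach0); apply: (iter_step_mean_le reach0) => s' sn.
exact: payoff_le (reach_admissible sn).
Qed.

Lemma expected_excess_ge0 n : 0 <= expected_excess n.
Proof.
rewrite -[leLHS](iter_step_mean_cst n _ reach0); apply: (iter_step_mean_le reach0) => s' sn.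
exact: excess_ge0 (reach_admissible sn).
Qed.

Lemma expected_excess_step n : expected_excess n.+1 <=
  expected_excess n - expected_excess n / n.+2%:R + (expected_payoff n.+1 - expected_payoff n).
Proof.
rewrite {1}/expected_excess iterSr.
apply: le_trans (iter_step_mean_le reach0 (g := fun s => (excess n s + (- n.+2%:R^-1) * excess n s)
  + (step_mean (payoff n.+1) s + -1 * payoff n s)) _) _.
  move=> s' sn; have := mean_excess (reach_admissible sn) (fun o => @next_admissible n s' o sn).
  by rewrite mulN1r mulNr [_^-1 * _]mulrC.
rewrite !iter_step_meanD !iter_step_meanZ -iterSr -/(expected_payoff _) -/(expected_payoff _).
by rewrite -/(expected_excess n) mulN1r mulNr [_^-1 * _]mulrC.
Qed.

Lemma expected_excess_small (eta : R) : 0 < eta ->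
  exists m, forall N, (m <= N)%N ->
    expected_excess m + (expected_payoff N - expected_payoff m) <= eta.
Proof.
exact: almost_supermartingale_small expected_excess_ge0 expected_excess_step
  expected_payoff_nondecreasing expected_payoff_le eta.
Qed.

(** The expected increase of [payoff] between times [n] and [N], given state [s] at time [n]. *)
Definition future_payoff N n s : R := iter (N - n) step_mean (payoff N) s - payoff n s.

Lemma future_payoff_ge0 N n s : (n <= N)%N -> reach n s -> 0 <= future_payoff N n s.
Proof.
move=> nN; rewrite /future_payoff; move: {2}(N - n)%N (erefl (N - n)%N) => k.
elim: k n s nN => [|k IH] n s nN Nnk sn; rewrite subr_ge0.
  have -> : n = N by apply/eqP; rewrite eqn_leq nN -subn_eq0 Nnk.
  by rewrite subnn.
rewrite Nnk; have n1N : (n < N)%N by rewrite -subn_gt0 Nnk.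
apply: le_trans (payoff_le_mean (reach_admissible sn) (fun o => @next_admissible n s o sn)) _.
apply: mean_le (reach_admissible sn) _ => o po; rewrite -subr_ge0.
have Nk : (N - n.+1)%N = k by rewrite subnS Nnk.
by have := IH n.+1 (next s o) n1N Nk (reach_next sn po); rewrite Nk.
Qed.

(** Adding the expected future payoff turns the excess into a nonnegative supermartingale up to time
    [N]: by [mean_excess], what the excess may gain is what the future payoff loses. *)
Lemma step_future N n s : (n < N)%N -> reach n s ->
  step_mean (fun s => excess n.+1 s + future_payoff N n.+1 s) s <=
  excess n s + future_payoff N n s.
Proof.
move=> nN sn; have Nn : (N - n)%N = (N - n.+1).+1 by rewrite subnSK.
rewrite {2}/future_payoff Nn iterS /step_mean meanD.
have -> : mean s (fun o => future_payoff N n.+1 (next s o)) =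
    mean s (fun o => iter (N - n.+1) step_mean (payoff N) (next s o))
    - mean s (fun o => payoff n.+1 (next s o)).
  by rewrite -mulN1r -meanZ -meanD; apply: eq_mean => o; rewrite mulN1r.
have := mean_excess (reach_admissible sn) (fun o => @next_admissible n s o sn).
have : 0 <= excess n s / n.+2%:R.
  by rewrite divr_ge0 ?(excess_ge0 n (reach_admissible sn))// ler0n.
move: (mean _ _) (mean _ _) (mean _ _) (_ / n.+2%:R) => ? ? ? ?.
by lra.
Qed.

(** * Convergence along a trajectory *)

Local Notation total := Defs.total.

Lemma normalizeE s i j : normalize s (i, j) = s (i, j) / total s.
Proof. by rewrite ffunE. Qed.

Lemma rowsum_normalize s i : rowsum (normalize s) i = rowsum s i / total s.
Proof. by rewrite /rowsum mulr_suml; apply: eq_bigr => j _; rewrite normalizeE. Qed.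

Lemma total_rowsum s : total s = \sum_i rowsum s i.
Proof. by rewrite /total /rowsum pair_big; apply: eq_bigr => -[]. Qed.

Lemma total_gt0 n s i j : admissible n s -> 0 < weight i j -> 0 < total s.
Proof.
move=> sn /weight_adj ij; rewrite total_rowsum (bigD1 i)//= ltr_pwDl//.
  exact: rowsum_gt0 sn ij.
by apply: sumr_ge0 => k _; exact: rowsum_ge0 sn _.
Qed.

Lemma ratioE (x : arr R T) i j : Defs.ratio adj a p x i j = weight i j * x (i, j) / (rowsum x i * rowsum x j).
Proof. by rewrite /Defs.ratio -/(weight i j); case: eqP => [->|//]; rewrite !mul0r. Qed.

Lemma FfunE (x : arr R T) i j :
  Ffun adj a p x (i, j) = x (i, j) * (Defs.ratio adj a p x i j - Hfun adj a p x).
Proof. by rewrite ffunE; case: eqP => [->|//]; rewrite mul0r. Qed.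

Lemma HfunE (x : arr R T) : (forall ij, 0 <= x ij) ->
  Hfun adj a p x = \sum_i \sum_j Defs.ratio adj a p x i j * x (i, j).
Proof.
move=> x0; rewrite /Hfun pair_big big_mkcond; apply: eq_bigr => -[i j] _ /=.
rewrite ratioE -/(weight i j); case: ltP => [_|xle]; first by rewrite expr2 !mulrA; ring.
by rewrite (@le_anti _ _ (x (i, j)) 0) ?mulr0// xle x0.
Qed.

Lemma normalize_ge0 n s ij : admissible n s -> 0 <= normalize s ij.
Proof.
move=> sn; case: ij => i j; rewrite normalizeE; apply: divr_ge0; first exact: admissible_ge0 sn _.
by apply: sumr_ge0 => ? _; exact: admissible_ge0 sn _.
Qed.

Definition edge_gap n s i j : R := `|rate s i j * s (i, j) - s (i, j) / n.+1%:R|.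

Definition gap_bound : R := total_weight + \sum_i \sum_j (v0 (i, j) + a i j).

(** [(m - u)^2] is [m + u] times the excess of the edge, and [gap_bound] bounds [m + u]. *)
Lemma edge_gap_le n s i j : admissible n s ->
  edge_gap n s i j <= Num.sqrt (gap_bound * excess n s).
Proof.
move=> sn; rewrite /edge_gap -sqrtr_sqr; apply: ler_wsqrtr.
have [t tE] : exists t : R, t = n.+1%:R by exists n.+1%:R.
have t0 : 0 < t by rewrite tE ltr0n.
rewrite -tE; have r0 := rate_ge0 i j sn; have X0 := admissible_ge0 sn (i, j).
have -> : (rate s i j * s (i, j) - s (i, j) / t) ^+ 2 =
    (rate s i j * s (i, j) + s (i, j) / t) * edge_excess t s i j.
  have D0 : 0 < t * rate s i j + 1 by rewrite addrC ltr_pwDl// mulr_ge0// ltW.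
  by rewrite /edge_excess; field; rewrite !gt_eqF.
apply: ler_pM.
- by apply: addr_ge0; [exact: mulr_ge0|apply: divr_ge0 => //; exact: ltW].
- by apply: edge_excess_ge0 sn _; exact: ltW.
- apply: lerD; first by apply: le_trans (rate_le_weight i j sn) (weight_le i j).
  apply: (@le_trans _ _ (v0 (i, j) + a i j)).
    rewrite ler_pdivrMr//; apply: le_trans (adm_le sn i j) _.
    rewrite [leRHS]mulrC mulrDr; apply: lerD.
      by rewrite ler_peMl// tE ler1n.
    by rewrite ler_wpM2r// tE ler_nat.
  rewrite (bigD1 i)//= (bigD1 j)//= -addrA lerDl addr_ge0//.
    by apply: sumr_ge0 => l _; rewrite addr_ge0.
  by apply: sumr_ge0 => k _; apply: sumr_ge0 => l _; rewrite addr_ge0.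
rewrite /excess -tE (bigD1 i)//= (bigD1 j)//= -addrA lerDl addr_ge0//.
  by apply: sumr_ge0 => l _; apply: edge_excess_ge0 sn _; exact: ltW.
by apply: sumr_ge0 => k _; apply: sumr_ge0 => l _; apply: edge_excess_ge0 sn _; exact: ltW.
Qed.

(** The product of [ratio] and the entry is homogeneous of degree 0 in the array. *)
Lemma ratio_normalize s i j : 0 < total s ->
  Defs.ratio adj a p (normalize s) i j * normalize s (i, j) = rate s i j * s (i, j).
Proof.
move=> t0; rewrite ratioE normalizeE !rowsum_normalize /rate.
have [Y0|Y0] := eqVneq (rowsum s i) 0; first by rewrite Y0 !(mul0r, invr0, mulr0).
have [Z0|Z0] := eqVneq (rowsum s j) 0; first by rewrite Z0 !(mul0r, invr0, mulr0).
by field; rewrite Y0 Z0 gt_eqF.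
Qed.

Lemma Hfun_normalize n s : admissible n s -> 0 < total s ->
  Hfun adj a p (normalize s) = total_rate s.
Proof.
move=> sn t0; rewrite HfunE => [|ij]; last exact: normalize_ge0 sn.
by do 2 (apply: eq_bigr => ? _); rewrite ratio_normalize.
Qed.

Lemma Ffun_normalize n s i j : admissible n s -> 0 < total s ->
  Ffun adj a p (normalize s) (i, j) =
  rate s i j * s (i, j) - s (i, j) / total s * total_rate s.
Proof.
move=> sn t0; rewrite FfunE (Hfun_normalize sn t0) mulrBr mulrC ratio_normalize//.
by rewrite normalizeE.
Qed.

Lemma Ffun_normalize_le n s i j : admissible n s -> 0 < total s ->
  `|Ffun adj a p (normalize s) (i, j)| <=
  (1 + #|T|%:R ^+ 2) * Num.sqrt (gap_bound * excess n s).
Proof.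
move=> sn t0; rewrite (Ffun_normalize _ _ sn t0).
have -> : rate s i j * s (i, j) - s (i, j) / total s * total_rate s =
    (rate s i j * s (i, j) - s (i, j) / n.+1%:R) +
    s (i, j) / total s * (total s / n.+1%:R - total_rate s).
  have : (n.+1%:R : R) != 0 by rewrite pnatr_eq0.
  by move: (n.+1%:R : R) => t t1; field; rewrite t1 gt_eqF.
apply: le_trans (ler_normD _ _) _; rewrite mulrDl mul1r; apply: lerD.
  exact: edge_gap_le.
rewrite normrM -[leRHS]mul1r; apply: ler_pM => //.
  rewrite ger0_norm; last by rewrite divr_ge0 ?(admissible_ge0 sn)// ltW.
  rewrite ler_pdivrMr// mul1r total_rowsum (bigD1 i)//= ler_wpDr//.
    by apply: sumr_ge0 => k _; exact: rowsum_ge0 sn _.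
  exact: admissible_le_rowsum sn _ _.
have -> : total s / n.+1%:R - total_rate s =
    \sum_i \sum_j (s (i, j) / n.+1%:R - rate s i j * s (i, j)).
  rewrite total_rowsum mulr_suml /total_rate -sumrB; apply: eq_bigr => k _.
  by rewrite mulr_suml -sumrB.
apply: le_trans (ler_norm_sum _ _ _) _.
apply: (@le_trans _ _ (\sum_(k : T) \sum_(l : T) Num.sqrt (gap_bound * excess n s))).
  apply: ler_sum => k _; apply: le_trans (ler_norm_sum _ _ _) _.
  by apply: ler_sum => l _; rewrite distrC; exact: edge_gap_le.
rewrite sumr_const -[leLHS]mulr_natr sumr_const -[X in X * _]mulr_natr.
by rewrite expr2 mulrC mulrAC mulrA mulrC mulrA.
Qed.

(** The mass on edges of weight 0 is frozen and the remaining mass can only grow, so its share stays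
    at least [h1 v0]. *)
Lemma normalize_Delta n s i j : admissible n s -> 0 < weight i j ->
  Delta adj a p v0 (normalize s).
Proof.
move=> sn wij; have t0 := total_gt0 sn wij.
have t00 : 0 < total v0 by exact: total_gt0 (reach_admissible reach0) wij.
split; first by move=> k l; rewrite !normalizeE (admC sn).
split; first by move=> ij; exact: normalize_ge0 sn.
split; first by move=> k l nkl; rewrite normalizeE (adm_nadj sn)// mul0r.
split.
  rewrite /total; under eq_bigr do rewrite ffunE.
  by rewrite -mulr_suml divff// gt_eqF.
rewrite /h1; under [leRHS]eq_bigr do rewrite ffunE.
rewrite -mulr_suml ler_pdivrMr// mulrAC ler_pdivlMr//.
pose Q (ij : T * T) := 0 < a ij.1 ij.2 * pij adj p ij.1 ij.2.
have split_total (y : arr R T) : total y = \sum_(ij | Q ij) y ij + \sum_(ij | ~~ Q ij) y ij.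
  by rewrite /total (bigID Q).
rewrite (split_total s) (split_total v0).
have -> : \sum_(ij | ~~ Q ij) s ij = \sum_(ij | ~~ Q ij) v0 ij.
  apply: eq_bigr => -[k l] nQ; apply: (adm_weight0 sn).
  by apply/eqP; rewrite eq_le weight_ge0 andbT leNgt.
have : \sum_(ij | Q ij) v0 ij <= \sum_(ij | Q ij) s ij.
  by apply: ler_sum => ij _; exact: adm_ge sn _.
have : 0 <= \sum_(ij | ~~ Q ij) v0 ij by exact: sumr_ge0.
rewrite -/(Q _); move: (\sum_(ij | Q ij) v0 ij) (\sum_(ij | Q ij) s ij) (\sum_(ij | ~~ _) _) => A A' B.
by nra.
Qed.

(** * Limits of one trajectory with vanishing excess *)

Section Trajectory.
Variable s : nat -> arr R T.
Hypothesis s_admissible : forall n, admissible n (s n).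
Hypothesis s_excess : (fun n => excess n (s n)) @ \oo --> (0 : R).
Hypothesis weight_pos : exists i j, 0 < weight i j.

Let x n := normalize (s n).

Lemma total_pos n : 0 < total (s n).
Proof. by have [i [j wij]] := weight_pos; exact: total_gt0 (s_admissible n) wij. Qed.

Lemma Delta_trajectory n : Delta adj a p v0 (x n).
Proof. by have [i [j wij]] := weight_pos; exact: normalize_Delta (s_admissible n) wij. Qed.

Lemma Ffun_cvg ij : (fun n => Ffun adj a p (x n) ij) @ \oo --> (0 : R).
Proof.
case: ij => i j; apply: norm_cvg0.
apply: (@squeeze_cvgr _ _ _ _ (fun=> 0)
  (fun n => (1 + #|T|%:R ^+ 2) * Num.sqrt (gap_bound * excess n (s n)))).
- by apply: nearW => n; rewrite normr_ge0 (Ffun_normalize_le _ _ (s_admissible n))// total_pos.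
- exact: cvg_cst.
have -> : 0 = (1 + #|T|%:R ^+ 2) * Num.sqrt (gap_bound * 0) :> R by rewrite mulr0 sqrtr0 mulr0.
apply: cvgMr; apply: continuous_cvg; first exact: sqrt_continuous.
exact: cvgMr.
Qed.

(* [Hfun] is discontinuous on the boundary of [Delta], but only through edges
   whose weight vanishes in the limit; on the other edges [ratio] converges,
   necessarily to the limit of [Hfun]. *)
Lemma ultralimit_Gamma (G : set_system nat) (GU : UltraFilter G) (y : arr R T) :
  \oo `<=` G -> (forall ij, (fun n => x n ij) @ G --> y ij) -> Gamma adj a p v0 y.
Proof.
move=> ooG xy.
have xD := Delta_trajectory.
have y_ge0 ij : 0 <= y ij.
  apply: (@cvgr_to_ge _ G _ _ _ _ _ (xy ij)); apply: filterE => n.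
  by have [_ [x0 _]] := xD n; exact: x0.
have y_total : total y = 1.
  apply: (cvg_unique (@Rhausdorff R) (F := (fun n => total (x n)) @ G)).
    by apply: cvg_sumr.
  have -> : (fun n => total (x n)) = fun=> 1.
    by apply/funext => n; have [_ [_ [_ [-> _]]]] := xD n.
  exact: cvg_cst.
have yD : Delta adj a p v0 y.
  split=> [i j|].
    apply: (cvg_unique (@Rhausdorff R) (F := (fun n => x n (i, j)) @ G)); first exact: xy.
    have -> : (fun n => x n (i, j)) = (fun n => x n (j, i)); last exact: xy.
    by apply/funext => n; have [xC _] := xD n; exact: xC.
  split=> //; split=> [i j nij|].
    apply: (cvg_unique (@Rhausdorff R) (F := (fun n => x n (i, j)) @ G)); first exact: xy.
    have -> : (fun n => x n (i, j)) = (fun=> 0); last exact: cvg_cst.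
    by apply/funext => n; have [_ [_ [xn _]]] := xD n; exact: xn.
  split=> //.
  pose Q (ij : T * T) := 0 < a ij.1 ij.2 * pij adj p ij.1 ij.2.
  apply: (@cvgr_to_ge _ G _ _ (fun n => \sum_(ij | Q ij) x n ij)).
    by apply: cvg_sumr.
  by apply: filterE => n; have [_ [_ [_ [_]]]] := xD n.
split => //.
have row_y i : (fun n => rowsum (x n) i) @ G --> rowsum y i by apply: cvg_sumr.
have H_bnd n : 0 <= Hfun adj a p (x n) <= total_weight.
  rewrite (Hfun_normalize (s_admissible n) (total_pos n)); apply/andP; split.
    do 2 (apply: sumr_ge0 => ? _).
    by rewrite mulr_ge0 ?(admissible_ge0 (s_admissible n))// (rate_ge0 _ _ (s_admissible n)).
  by do 2 (apply: ler_sum => ? _); exact: rate_le_weight (s_admissible n).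
(* The limit of [Hfun] along [G] comes from compactness alone; it is identified with [Hfun] at [y]
   only at the end. *)
have [h Hh] := ultra_bounded_cvg GU H_bnd.
have row_pos i j : 0 < y (i, j) -> 0 < rowsum y i.
  by move=> yij; rewrite /rowsum (bigD1 j)//= ltr_pwDl// sumr_ge0.
have ratio_h i j : y (i, j) != 0 -> Defs.ratio adj a p y i j = h.
  move=> yij0; have yij : 0 < y (i, j) by rewrite lt_neqAle eq_sym yij0 y_ge0.
  have yji : 0 < y (j, i) by have [<- _] := yD.
  have ratio_cvg : (fun n => Defs.ratio adj a p (x n) i j) @ G --> Defs.ratio adj a p y i j.
    rewrite ratioE; under eq_fun do rewrite ratioE.
    apply: cvgM; first by apply: cvgMr; exact: xy.
    apply: cvgV; last by apply: cvgM; exact: row_y.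
    by rewrite mulf_neq0// gt_eqF// (row_pos _ _ yij, row_pos _ _ yji).
  have : y (i, j) * (Defs.ratio adj a p y i j - h) = 0.
    apply: (cvg_unique (@Rhausdorff R) (F := (fun n => Ffun adj a p (x n) (i, j)) @ G)).
      rewrite /= (_ : (fun n => _) = fun n => x n (i, j) *
          (Defs.ratio adj a p (x n) i j - Hfun adj a p (x n))).
        by apply: cvgM; [exact: xy|exact: cvgB].
      by apply/funext => n; rewrite FfunE.
    by apply: (cvg_trans _ (Ffun_cvg (i, j))) => A; exact: ooG.
  by move/eqP; rewrite mulf_eq0 (negPf yij0) subr_eq0 => /eqP.
(* [ratio] equals [h] wherever [y] does not vanish, so [Hfun] at [y] is [h] times the total mass
   1. *)
have Hy : Hfun adj a p y = h.
  rewrite HfunE// -[RHS]mulr1 -y_total total_rowsum mulr_sumr; apply: eq_bigr => i _.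
  rewrite mulr_sumr; apply: eq_bigr => j _.
  by have [->|/ratio_h ->//] := eqVneq (y (i, j)) 0; rewrite !mulr0.
apply/ffunP => -[i j]; rewrite FfunE Hy [RHS]ffunE.
by have [->|/ratio_h ->] := eqVneq (y (i, j)) 0; rewrite ?mul0r ?subrr ?mulr0.
Qed.

Lemma eucl_ge0 (y z : arr R T) : 0 <= eucl y z.
Proof. exact: sqrtr_ge0. Qed.

(** Otherwise the times at which [x] is [eps]-far from [Gamma] are unbounded and lie in an
    ultrafilter finer than [\oo]. All coordinates converge along it, and [ultralimit_Gamma] puts the
    limit in [Gamma]. *)
Lemma near_Gamma (eps : R) : 0 < eps ->
  \forall n \near \oo, exists2 y, Gamma adj a p v0 y & eucl (x n) y < eps.
Proof.
move=> eps0; apply: contrapT => far.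
pose B := [set n | forall y, Gamma adj a p v0 y -> eps <= eucl (x n) y].
have FB : ProperFilter (within B \oo).
  apply: Build_ProperFilter => nB; apply: far.
  have : \forall n \near \oo, ~ B n by exact: nB.
  apply: filterS => n {}nB.
  apply: contrapT => /forall2NP ney; apply: nB => y yG.
  by have [//|/negP] := ney y; rewrite -leNgt.
have [G [GU BG]] := ultraFilterLemma FB.
have ooG : \oo `<=` G by move=> A oA; apply: BG; apply: filterS oA => n An _.
have GB : G B by apply: BG; exact: withinT.
have xle ij n : 0 <= x n ij <= 1.
  have [_ [x0 [_ [<- _]]]] := Delta_trajectory n.
  by rewrite x0 /total (bigD1 ij)//= lerDl sumr_ge0.
have /choice[l xl] : forall ij, exists l : R, (fun n => x n ij) @ G --> l.
  by move=> ij; exact: ultra_bounded_cvg (xle ij).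
pose y : arr R T := [ffun ij => l ij].
have xy ij : (fun n => x n ij) @ G --> y ij by rewrite ffunE.
have yG := ultralimit_Gamma GU ooG xy.
have : (fun n => eucl (x n) y) @ G --> (0 : R).
  have -> : 0 = Num.sqrt (\sum_(ij : T * T) 0) :> R by rewrite big1 ?sqrtr0.
  apply: continuous_cvg; first exact: sqrt_continuous.
  apply: cvg_sumr => ij; rewrite -[X in _ --> X](expr0n R 2) -(subrr (y ij)).
  by apply: cvgM; apply: cvgB => //; exact: cvg_cst.
move/cvgr0_norm_lt => /(_ _ eps0) small.
have [n [nB]] := filter_ex (filterI GB small).
by rewrite ger0_norm ?eucl_ge0// ltNge nB.
Qed.

Lemma dist_Gamma_cvg : (fun n => dist_set (x n) (Gamma adj a p v0)) @ \oo --> 0%E.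
Proof.
have dist_ge0 n : (0 <= dist_set (x n) (Gamma adj a p v0))%E.
  by apply: le_ereal_inf_tmp => _ [y _ <-]; rewrite lee_fin eucl_ge0.
have dist_lt (eps : R) : 0 < eps ->
    \forall n \near \oo, (dist_set (x n) (Gamma adj a p v0) < eps%:E)%E.
  move=> /near_Gamma; apply: filterS => n [y yG xy].
  by apply: (@le_lt_trans _ _ (eucl (x n) y)%:E); [apply: ereal_inf_lbound; exists y|rewrite lte_fin].
(* Eventual finiteness comes first: the distance to an empty set would be [+oo], which [dist_lt]
   excludes. *)
apply/fine_cvgP; split.
  apply: filterS (dist_lt 1 ltr01) => n lt1.
  by rewrite ge0_fin_numE// (lt_le_trans lt1)// leey.
apply/cvgr0Pnorm_lt => eps /dist_lt; apply: filterS => n lte /=.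
rewrite ger0_norm ?fine_ge0//.
by rewrite -lte_fin fineK// ge0_fin_numE// (lt_le_trans lte)// leey.
Qed.

End Trajectory.

(** * Ville's inequality for the chain *)

Section Chain.
Context (d : measure_display) (Omega : measurableType d) (P : probability Omega R).
Variable V : nat -> Omega -> arr R T.
Implicit Types h : nat -> arr R T.

Hypothesis V_measurable : forall n s, measurable [set w | V n w = s].
Hypothesis V_init : P [set w | V 0 w = v0] = 1%E.
Hypothesis V_step : forall (n : nat) (s : nat -> arr R T),
  P [set w | forall k, (k <= n.+1)%N -> V k w = s k] =
  (P [set w | forall k, (k <= n)%N -> V k w = s k] *
   (rl_kernel adj a p (s n) (s n.+1))%:E)%E.

(** * Cylinder events and the Markov property *)

Definition cylinder n (s : nat -> arr R T) : set Omega :=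
  [set w | forall k, (k <= n)%N -> V k w = s k].

Definition extend n (s : nat -> arr R T) x : nat -> arr R T :=
  fun k => if k == n then x else s k.

Lemma cylinder_extend n h x :
  cylinder n.+1 (extend n.+1 h x) = cylinder n h `&` [set w | V n.+1 w = x].
Proof.
apply/seteqP; split => [w Cw|w [Cw xw] k].
  split => [k kn|]; last by have := Cw _ (leqnn _); rewrite /extend eqxx.
  by have := Cw k (leqW kn); rewrite /extend ltn_eqF.
rewrite leq_eqVlt /extend; case: eqP => [-> //|_ /= kn]; exact: Cw.
Qed.

Lemma cylinder_extend_lt n h x : cylinder n (extend n.+1 h x) = cylinder n h.
Proof.
by apply/seteqP; split => w Cw k kn; have := Cw k kn; rewrite /extend ltn_eqF.
Qed.

Lemma cylinder0 h : cylinder 0 h = [set w | V 0 w = h 0%N].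
Proof. by apply/seteqP; split => [w /(_ 0%N)|w Vw [|k]]; [exact|by []|by []]. Qed.

Lemma cylinder_measurable n h : measurable (cylinder n h).
Proof.
elim: n h => [|n IH] h; first by rewrite cylinder0.
have -> : cylinder n.+1 h = cylinder n h `&` [set w | V n.+1 w = h n.+1].
  apply/seteqP; split => [w Cw|w [Cw Vw] k].
    by split => [k kn|]; apply: Cw => //; exact: leqW.
  by rewrite leq_eqVlt => /predU1P[-> //|]; exact: Cw.
exact: measurableI.
Qed.

Lemma cylinder_step n h x :
  (P (cylinder n h `&` [set w | V n.+1 w = x]) =
   P (cylinder n h) * (rl_kernel adj a p (h n) x)%:E)%E.
Proof.
rewrite -cylinder_extend /cylinder V_step -!/(cylinder _ _) cylinder_extend_lt.
by rewrite /extend eqxx ltn_eqF.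
Qed.

Lemma measurable_notin n (l : seq (arr R T)) : measurable [set w | V n w \notin l].
Proof.
elim: l => [|x l IH].
  by rewrite (_ : [set _ | _] = setT)//; apply/seteqP; split.
have -> : [set w | V n w \notin x :: l] = ~` [set w | V n w = x] `&` [set w | V n w \notin l].
  apply/seteqP; split => w /=; rewrite in_cons negb_or.
    by move=> /andP[/eqP].
  by move=> [/eqP -> ->].
by apply: measurableI => //; exact: measurableC.
Qed.

(** The space of arrays is not countable in general, so finitely many values are separated from a
    remainder, to be shown null. *)
Lemma split_by_value n (E : set Omega) (l : seq (arr R T)) : measurable E -> uniq l ->
  (P E = P (E `&` [set w | V n w \notin l]) + \sum_(x <- l) P (E `&` [set w | V n w = x]))%E.
Proof.
move=> mE; elim: l => [|x l IH] /=.
  by move=> _; rewrite big_nil adde0; congr (P _); apply/seteqP; split => // w [].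
move=> /andP[xl ul]; rewrite big_cons addeA [LHS](IH ul); congr (_ + _)%E.
rewrite -measureU; last 3 first.
- by apply: measurableI => //; exact: measurable_notin.
- exact: measurableI.
- apply/seteqP; split => // w [[_ /=]]; rewrite in_cons negb_or => /andP[/eqP + _] [_ /=].
  by [].
congr (P _); apply/seteqP; split => w /=.
  move=> [Ew Vl]; have [Vx|/eqP Vx] := pselect (V n w = x); first by right.
  by left; split=> //; rewrite in_cons negb_or Vx.
case=> -[Ew]; first by rewrite in_cons negb_or => /andP[_ ->].
by move=> ->.
Qed.

Definition successors s : seq (arr R T) := undup [seq next s o | o <- enum {: outcome}].

Lemma rl_kernelE s x : rl_kernel adj a p s x = mean s (fun o => (x == next s o)%:R).
Proof. by rewrite /rl_kernel -mean_pair. Qed.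

Lemma sum_successors s (r : arr R T -> R) :
  \sum_(x <- successors s) rl_kernel adj a p s x * r x = step_mean r s.
Proof.
under eq_bigr do rewrite rl_kernelE mulr_suml.
rewrite exchange_big; apply: eq_bigr => o _.
under eq_bigr do rewrite -mulrA.
rewrite -mulr_sumr; congr (_ * _).
have os : next s o \in successors s by rewrite mem_undup map_f// mem_enum.
rewrite (bigD1_seq (next s o))//= ?undup_uniq// eqxx mul1r big1 ?addr0// => x /negPf ->.
by rewrite mul0r.
Qed.

Lemma reach_kernel n s x : reach n s -> rl_kernel adj a p s x != 0 -> reach n.+1 x.
Proof.
rewrite rl_kernelE => sn k0; apply: contrapT => nx; move/eqP: k0; apply.
apply: big1 => o _; have [->|/outcome_prob_gt0 po] := eqVneq (outcome_prob s o) 0.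
  by rewrite mul0r.
case: eqP => [xo|_]; last by rewrite mulr0.
by case: nx; rewrite xo; exact: reach_next.
Qed.

(** Takes the place of conditional expectations: bounds on [E] given each one-step continuation of a
    history are averaged into a bound given that history. *)
Lemma markov_step n h (E : set Omega) (r : arr R T -> R) : measurable E -> reach n (h n) ->
  (forall x, reach n.+1 x ->
    (P (cylinder n.+1 (extend n.+1 h x) `&` E) <=
     P (cylinder n.+1 (extend n.+1 h x)) * (r x)%:E)%E) ->
  (P (cylinder n h `&` E) <= P (cylinder n h) * (step_mean r (h n))%:E)%E.
Proof.
move=> mE sn H; have mC := cylinder_measurable n h; set l := successors (h n).
have ul : uniq l by exact: undup_uniq.
have finC : (P (cylinder n h) \is a fin_num)%E by exact: fin_num_measure.
have sumK : (\sum_(x <- l) P (cylinder n h `&` [set w | V n.+1 w = x]) = P (cylinder n h))%E.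
  under eq_bigr do rewrite cylinder_step.
  rewrite -ge0_sume_distrr => [|x _]; last first.
    by rewrite lee_fin rl_kernelE; apply: (mean_ge0 (reach_admissible sn)) => o; rewrite ler0n.
  rewrite sumEFin (eq_bigr (fun x => rl_kernel adj a p (h n) x * 1)) => [|x _]; last by rewrite mulr1.
  by rewrite sum_successors /step_mean (mean_cst _ (reach_admissible sn)) mule1.
(* The kernel puts mass 1 on [successors], so leaving that list has probability 0. *)
have null : P (cylinder n h `&` [set w | V n.+1 w \notin l]) = 0%E.
  have := split_by_value n.+1 mC ul; rewrite sumK.
  by move=> PC; rewrite -[LHS](addeK _ finC) -PC subee.
have mE' := measurableI _ _ mC mE.
rewrite (split_by_value n.+1 mE' ul) -sum_successors.
have -> : P (cylinder n h `&` E `&` [set w | V n.+1 w \notin l]) = 0%E.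
  apply: subset_measure0 null; first by apply: measurableI => //; exact: measurable_notin.
    by apply: measurableI => //; exact: measurable_notin.
  by move=> w [[]].
have -> : P (cylinder n h) = (fine (P (cylinder n h)))%:E by rewrite fineK.
rewrite add0e -EFinM mulr_sumr -sumEFin; apply: lee_sum => x _.
rewrite mulrA EFinM EFinM fineK// -cylinder_step setIAC.
(* [successors] also lists results of outcomes of probability 0; they may lie outside [reach], but
   their event is null. *)
have [k0|k0] := eqVneq (rl_kernel adj a p (h n) x) 0; last first.
  by rewrite -cylinder_extend; apply: H; exact: reach_kernel k0.
apply: (@le_trans _ _ (P (cylinder n h `&` [set w | V n.+1 w = x]))).
  by apply: le_measure; rewrite ?inE//; [apply: measurableI => //; exact: measurableI|exact: measurableI].
by rewrite cylinder_step k0 mule0 mul0e.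
Qed.

Lemma restrict_init (E : set Omega) : measurable E ->
  P E = P (cylinder 0 (fun=> v0) `&` E).
Proof.
move=> mE; rewrite cylinder0 setIC.
have := split_by_value 0 mE (isT : uniq [:: v0]); rewrite big_seq1 => ->.
rewrite [X in (X + _)%E](_ : _ = 0%E) ?add0e//.
apply: (@subset_measure0 _ _ _ _ _ [set w | V 0 w \notin [:: v0]]).
- by apply: measurableI => //; exact: measurable_notin.
- exact: measurable_notin.
- by move=> w [].
have := split_by_value 0 (@measurableT _ Omega) (isT : uniq [:: v0]).
rewrite big_seq1 !setTI V_init probability_setT => PC.
have fin1 : (1%E : \bar R) \is a fin_num by [].
by rewrite -[LHS](addeK _ fin1) -PC subee.
Qed.

(** Measurability is known only for the events [V n w = s]; finiteness extends it to events about
    reachable states. *)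
Lemma reach_finite n : finite_set (reach n).
Proof.
elim: n => [|n IH]; first exact: finite_set1.
by apply: bigcup_finite => // s _; apply: finite_image; exact: finite_finset.
Qed.

Lemma value_measurable n (A : set (arr R T)) : finite_set A -> measurable [set w | A (V n w)].
Proof.
move=> finA; rewrite (_ : [set w | A (V n w)] = \bigcup_(s in A) [set w | V n w = s]).
  exact: fin_bigcup_measurable.
by apply/seteqP; split => [w Aw|w [s As /= ->]//]; exists (V n w).
Qed.

(** Induction on the number of remaining steps, using [markov_step] with the bound 0. *)
Lemma ae_reach n : {ae P, forall w, reach n (V n w)}.
Proof.
have mE : measurable (~` [set w | reach n (V n w)]).
  by apply: measurableC; apply: value_measurable; exact: reach_finite.
exists (~` [set w | reach n (V n w)]); split => //.
suff H k m h : (m + k)%N = n -> reach m (h m) ->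
    (P (cylinder m h `&` ~` [set w | reach n (V n w)]) <= 0)%E.
  by apply/le_anti/andP; split; rewrite ?measure_ge0// (restrict_init mE) (H n).
elim: k m h => [|k IH] m h mkn rm.
  rewrite (_ : _ `&` _ = set0) ?measure0//.
  by apply/seteqP; split => // w [Cw]; apply; rewrite /= -mkn addn0 Cw.
apply: le_trans (markov_step (r := fun=> 0) mE rm _) _.
  move=> x rx; rewrite mule0; apply: IH; first by rewrite addSnnS.
  by rewrite /extend eqxx.
by rewrite /step_mean (mean_cst _ (reach_admissible rm)) mule0.
Qed.

Section Ville.
Variables (N : nat) (S : nat -> set (arr R T)) (g : nat -> arr R T -> R).
Hypothesis g_ge0 : forall n s, (n <= N)%N -> reach n s -> 0 <= g n s.
Hypothesis g_step : forall n s, (n < N)%N -> reach n s -> step_mean (g n.+1) s <= g n s.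
Hypothesis g_hit : forall n s, (n <= N)%N -> reach n s -> S n s -> 1 <= g n s.

(** Requiring [reach k] makes the event measurable for arbitrary sets [S k]. *)
Definition hit n : set Omega :=
  [set w | exists k, [/\ (n <= k)%N, (k <= N)%N, reach k (V k w) & S k (V k w)]].

Lemma hit_measurable n : measurable (hit n).
Proof.
rewrite (_ : hit n = \bigcup_k [set w | ([set s | (n <= k <= N)%N] `&` (reach k `&` S k)) (V k w)]).
  apply: bigcup_measurable => k _; apply: value_measurable.
  by apply/finite_setIr/finite_setIl/reach_finite.
apply/seteqP; split => [w [k [nk kN rk Sk]]|w [k _ [/andP[nk kN] [rk Sk]]]].
  by exists k => //; rewrite nk kN.
by exists k.
Qed.

Lemma cylinder_hit_le n h : (P (cylinder n h `&` hit n) <= P (cylinder n h))%E.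
Proof.
apply: le_measure; rewrite ?inE//; last exact: cylinder_measurable.
by apply: measurableI; [exact: cylinder_measurable|exact: hit_measurable].
Qed.

(** Induction on the remaining time. If the current state lies in [S n], then [g] is at least 1; if
    not, a hit must occur from [n.+1] on, and [markov_step] with [g_step] concludes. *)
Lemma ville_cylinder n h : (n <= N)%N -> reach n (h n) ->
  (P (cylinder n h `&` hit n) <= P (cylinder n h) * (g n (h n))%:E)%E.
Proof.
move: {2}(N - n)%N (erefl (N - n)%N) => k.
elim: k n h => [|k IH] n h Nnk nN rn.
  have En : n = N by apply/eqP; rewrite eqn_leq nN -subn_eq0 Nnk.
  have [Sn|nSn] := pselect (S n (h n)).
    apply: le_trans (cylinder_hit_le _ _) _.
    by rewrite lee_pemulr// lee_fin; exact: g_hit.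
  rewrite (_ : _ `&` _ = set0).
    by rewrite measure0 mule_ge0// lee_fin; exact: g_ge0.
  apply/seteqP; split => // w [Cw [j [nj jN rj Sj]]].
  have jn : j = n by apply/eqP; rewrite eqn_leq nj En jN.
  by apply: nSn; move: Sj; rewrite jn Cw.
have [Sn|nSn] := pselect (S n (h n)).
  apply: le_trans (cylinder_hit_le _ _) _.
  by rewrite lee_pemulr// lee_fin; exact: g_hit.
have nN' : (n < N)%N by rewrite -subn_gt0 Nnk.
rewrite (_ : _ `&` _ = cylinder n h `&` hit n.+1).
  apply: le_trans (markov_step (r := g n.+1) (hit_measurable _) rn _) _.
    move=> x rx; have := IH n.+1 (extend n.+1 h x); rewrite /extend eqxx.
    by apply => //; rewrite subnS Nnk.
  by apply: lee_wpmul2l => //; rewrite lee_fin; exact: g_step.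
apply/seteqP; split => w [Cw [j [nj jN rj Sj]]]; split => //; exists j; split => //.
  rewrite ltn_neqAle nj andbT; apply: contra_not_neq nSn => jn.
  by move: Sj; rewrite -jn Cw.
exact: ltnW.
Qed.

Lemma ville : (P (hit 0) <= (g 0 v0)%:E)%E.
Proof.
have := @ville_cylinder 0 (fun=> v0) (leq0n _) erefl.
by rewrite -(restrict_init (hit_measurable 0)) cylinder0 V_init mul1e.
Qed.

End Ville.

(** * Almost sure convergence of the excess *)

Definition exceed (eps : R) m n : set (arr R T) :=
  [set s | (m <= n)%N /\ eps <= excess n s].

Lemma hit_excess_le (eps : R) m N : 0 < eps -> (m <= N)%N ->
  (P (hit N (exceed eps m) 0) <=
   (eps^-1 * (expected_excess m + (expected_payoff N - expected_payoff m)))%:E)%E.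
Proof.
move=> eps0 mN.
pose f k s := excess k s + future_payoff N k s.
(* From time [m] on, [g] is the supermartingale [f] divided by [eps]; before [m] it is the
   conditional expectation of its value at [m]. Truncated subtraction and [maxn] cover both
   cases. *)
pose g n s := eps^-1 * iter (m - n) step_mean (f (maxn m n)) s.
have f0 k s : (k <= N)%N -> reach k s -> 0 <= f k s.
  move=> kN sk; rewrite addr_ge0 ?future_payoff_ge0//.
  exact: excess_ge0 (reach_admissible sk).
have ge n s : (m <= n)%N -> g n s = eps^-1 * f n s.
  by rewrite /g -subn_eq0 => /eqP mn; rewrite mn/= (maxn_idPr _)// -subn_eq0 mn.
have epsV : 0 <= eps^-1 by rewrite invr_ge0 ltW.
apply: le_trans (@ville N _ g _ _ _) _.
- move=> n s nN sn; apply: mulr_ge0 => //.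
  rewrite -[leLHS](iter_step_mean_cst (m - n) 0 sn).
  apply: (iter_step_mean_le sn) => s'; rewrite -maxnE maxnC; apply: f0.
  by rewrite geq_max mN.
- move=> n s nN sn; have [mn|nm] := leqP m n.
    rewrite ge// /step_mean (@eq_mean s _ (fun o => eps^-1 * f n.+1 (next s o))) => [|o]; last first.
      by rewrite ge// leqW.
    rewrite meanZ; apply: ler_wpM2l => //; exact: step_future.
  rewrite /g (maxn_idPl nm) (maxn_idPl (ltnW nm)) -(subnSK nm) iterS /step_mean meanZ.
  exact: lexx.
- move=> n s nN sn [mn es]; rewrite ge// mulrC ler_pdivlMr// mul1r.
  by rewrite (le_trans es)// lerDl future_payoff_ge0.
rewrite lee_fin; apply: ler_wpM2l => //; rewrite maxn0 subn0 /f iter_step_meanD lerD2l.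
rewrite -[leLHS]/(iter m step_mean (fun s => iter (N - m) step_mean (payoff N) s - payoff m s) v0).
have -> : (fun s => iter (N - m) step_mean (payoff N) s - payoff m s) =
   (fun s => iter (N - m) step_mean (payoff N) s + -1 * payoff m s).
  by apply/funext => s; rewrite mulN1r.
by rewrite iter_step_meanD iter_step_meanZ mulN1r -iterD subnKC.
Qed.

(** The exceptional set lies in every [Z m], the event that the excess reaches [eps] after time [m].
    By continuity from below in the horizon [N], some [Z m] has probability at most any given
    [eta]. *)
Lemma ae_excess_lt (eps : R) : 0 < eps ->
  {ae P, forall w, exists m, forall k, (m <= k)%N -> reach k (V k w) -> excess k (V k w) < eps}.
Proof.
move=> eps0; pose S := exceed eps.
pose Z m := \bigcup_N hit N (S m) 0.
have mZ m : measurable (Z m) by apply: bigcup_measurable => N _; exact: hit_measurable.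
exists (\bigcap_m Z m); split.
- exact: bigcap_measurable.
- apply/le_anti/andP; split; last exact: measure_ge0.
  apply/lee_addgt0Pr => eta eta0; rewrite add0e.
  (* The factor [eps] cancels the [eps^-1] of [hit_excess_le]. *)
  have [m mP] := expected_excess_small (mulr_gt0 eps0 eta0).
  apply: (@le_trans _ _ (P (Z m))).
    by apply: le_measure; rewrite ?inE//; [exact: bigcap_measurable|move=> w; exact].
  have Pcvg : (P \o (fun N => hit N (S m) 0)) N @[N --> \oo] --> P (Z m).
    apply: nondecreasing_cvg_mu; [by move=> N; exact: hit_measurable|exact: (mZ m)|].
    move=> N N' NN'; apply/subsetPset => w [k [nk kN rk Sk]].
    by exists k; split => //; exact: leq_trans NN'.
  rewrite -(cvg_lim _ Pcvg)//; apply: lime_le; first by apply/cvg_ex; exists (P (Z m)).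
  exists m => // N mN; apply: le_trans (hit_excess_le eps0 mN) _.
  by rewrite lee_fin mulrC ler_pdivrMr// mulrC; exact: mP.
move=> w /= /forallNP Hw m _; have /existsNP[k /not_implyP[mk /not_implyP[rk /negP]]] := Hw m.
by rewrite -leNgt => ek; exists k => //; exists k.
Qed.

Lemma ae_excess_cvg :
  {ae P, forall w, (forall n, reach n (V n w)) /\ (fun n => excess n (V n w)) @ \oo --> (0 : R)}.
Proof.
have A : {ae P, forall w, forall n, reach n (V n w)} by apply: ae_foralln; exact: ae_reach.
have B : {ae P, forall w, forall j : nat, exists m, forall k, (m <= k)%N ->
    reach k (V k w) -> excess k (V k w) < j.+1%:R^-1}.
  by apply: ae_foralln => j; apply: ae_excess_lt; rewrite invr_gt0 ltr0n.
apply: filterS2 A B => w rw ew; split => //.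
apply/cvgrPdist_lt => eps eps0.
have [j jP] : exists j : nat, (j.+1%:R : R)^-1 < eps.
  by have [j _ /(_ j (leqnn _)) jP] := near_infty_natSinv_lt (PosNum eps0); exists j.
have [m mP] := ew j; exists m => // k mk /=.
rewrite sub0r normrN ger0_norm; first exact: lt_trans (mP k mk (rw k)) jP.
exact: excess_ge0 (reach_admissible (rw k)).
Qed.

End Chain.

End Model.

Theorem theorem2 (R : realType) (T : finType) (adj : rel T)
  (a : T -> T -> R) (p : {set T} -> R) (v0 : arr R T)
  (d : measure_display) (Omega : measurableType d) (P : probability Omega R)
  (V : nat -> Omega -> arr R T) :
  (* finite simple graph *)
  (forall i j, adj i j = adj j i) -> (forall i, ~~ adj i i) ->
  (* reinforcement amounts *)
  (forall i j, 0 <= a i j) -> (forall i j, a i j = a j i) ->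
  (forall i j, 0 < a i j -> adj i j) ->
  (* law of W_n *)
  (forall W, 0 <= p W) -> \sum_(W : {set T}) p W = 1 ->
  (exists i j, 0 < a i j * pij adj p i j) ->
  (* initial weights *)
  (forall i j, v0 (i, j) = v0 (j, i)) -> (forall ij, 0 <= v0 ij) ->
  (forall i j, 0 < v0 (i, j) <-> adj i j) ->
  (* V is the process: V^0 = v0 and Markov transitions given by the model *)
  (forall n s, measurable [set w | V n w = s]) ->
  P [set w | V 0 w = v0] = 1%E ->
  (forall (n : nat) (s : nat -> arr R T),
     P [set w | forall k, (k <= n.+1)%N -> V k w = s k] =
     (P [set w | forall k, (k <= n)%N -> V k w = s k] *
      (rl_kernel adj a p (s n) (s n.+1))%:E)%E) ->
  (* conclusion: almost surely F(x_n) -> 0 and dist(x_n, Gamma) -> 0 *)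
  {ae P, forall w,
     (forall ij, (fun n => Ffun adj a p (normalize (V n w)) ij) @ \oo --> (0 : R)) /\
     ((fun n => dist_set (normalize (V n w)) (Gamma adj a p v0)) @ \oo --> 0%E)}.
Proof.
move=> adjC adj_irr a_ge0 aC _ p_ge0 p_sum weight_pos v0C v0_ge0 v0_adj V_meas V_init V_step.
have := ae_excess_cvg adjC adj_irr a_ge0 aC p_ge0 p_sum v0C v0_ge0 v0_adj V_meas V_init V_step.
apply: filterS => w [V_reach V_excess].
have V_adm n := reach_admissible adjC a_ge0 aC p_ge0 v0C v0_ge0 v0_adj (V_reach n).
split=> [ij|].
  exact: (Ffun_cvg adjC a_ge0 p_ge0 v0_ge0 v0_adj V_adm V_excess weight_pos).
exact: (dist_Gamma_cvg adjC a_ge0 aC p_ge0 v0C v0_ge0 v0_adj V_adm V_excess weight_pos).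
Qed.
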